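(* The edge-biregular maps on the sphere and on the projective plane are described as follows, according to the number of orbits of semi-edges. (i) (Both edge orbits consist of semi-edges.) Any semistar of even valency can be embedded in the sphere to form an edge-biregular map, and these even valency semistar maps on the sphere are also fully regular. A closed surface supporting an edge-biregular map in which both edge orbits consist of semi-edges must be the sphere. (ii) (Exactly one orbit of semi-edges.) Every edge-biregular map on the sphere or projective plane with exactly one orbit of semi-edges comes from a fully regular map by attaching one semi-edge in each corner. The sphere supports fully regular maps of types $(3,3)$, $(3,4)$, $(4,3)$, $(3,5)$, $(5,3)$, $(2,m)$ and $(m,2)$, and so there are edge-biregular maps on the sphere of types $(6,6)$, $(6,8)$, $(8,6)$, $(6,10)$, $(10,6)$, $(4,2m)$ and $(2m,4)$. Similarly the projective plane supports fully regular maps of types $(3,4)$, $(4,3)$, $(3,5)$, $(5,3)$, $(2,m)$ and $(m,2)$, and so there are edge-biregular maps on the projective plane of types $(6,8)$, $(8,6)$, $(6,10)$, $(10,6)$, $(4,2m)$ and $(2m,4)$. Here $m$ denotes a positive integer. (iii) (No semi-edges.) The proper edge-biregular maps on the sphere or on the projective plane can only be embedded even cycles and their duals, of types $(2,2m)$ and $(2m,2)$ respectively.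
   Context: A map is an embedding of a connected graph in a surface such that each face is homeomorphic to an open disc; semi-edges (edges with only one end attached to a vertex, the other end dangling) are allowed. An alternate-edge-colouring of a map is a colouring of its edges with two colours (shaded, unshaded) such that consecutive edges around every face, and consecutive edges around every vertex, have different colours. Flags are the faces of the barycentric subdivision; a corner is the pair of flags of one face which meet at a corner of that face, and consists of one flag of each colour. A map with an assigned alternate-edge-colouring is edge-biregular if its group $H$ of colour-preserving (and structure-preserving) automorphisms acts regularly on the set of corners; then $H$ has two orbits on edges, the shaded and the unshaded ones. Fixing a marked corner, $H$ is generated by involutions $r_0,r_2,\rho_0,\rho_2$ taking the marked corner to its neighbour respectively along the shaded edge, across the shaded edge, along the unshaded edge, across the unshaded edge; the shaded (resp. unshaded) edges are semi-edges when $r_0=r_2$ (resp. $\rho_0=\rho_2$). The type $(k,l)$ records the vertex valency $k$ and face length $l$, where semi-edges are counted among the edges at a vertex and around a face; for an edge-biregular map on a closed surface, $r_2\rho_2$ has order $k/2$ and $r_0\rho_0$ has order $l/2$. The map is proper if it has no semi-edges. A semistar is a map or graph with a single vertex all of whose edges are semi-edges. A fully regular map is one whose full automorphism group is transitive on flags. Given a fully regular map of type $(k,l)$ with automorphism group generated by the reflections $r_0,r_2$ (along and across an edge) and $r_1$ (across a corner), with all edges shaded, attaching one unshaded semi-edge in every corner gives the edge-biregular map $(H;r_0,r_2,\rho,\rho)$ with $\rho=\rho_0=\rho_2=r_1$, of type $(2k,2l)$. All surfaces here are closed (without boundary).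
   Formalization: On the projective plane, types (2,m), (m,2), (4,2m), (2m,4) in (ii) are asserted only for even m: for odd m they do not exist (valency 2 gives V=E, so F=1 and m=2E is even). *)

(* Defs.v *)
From HB Require Import structures.
From mathcomp Require Import all_boot all_order all_algebra all_fingroup.

Set Implicit Arguments.
Unset Strict Implicit.
Unset Printing Implicit Defensive.

Import GRing.Theory.

(* A map on a closed surface, given by its flags (the triangles of the
   barycentric subdivision) and the way they are glued: [along x], [turn x] and
   [across x] are the neighbours of [x] in the same face along its edge, in the
   same face across its corner, and on the other side of its edge.  The absence
   of fixed points says that the surface has no boundary, and finiteness that
   it is compact.  An edge with two ends carries four flags; a semi-edge carries
   two, which are swapped both by [along] and by [across]. *)
Record smap := SMap {
  flag :> finType;
  along : flag -> flag;
  turn : flag -> flag;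
  across : flag -> flag;
  alongK : involutive along;
  turnK : involutive turn;
  acrossK : involutive across;
  along_neq : forall x, along x != x;
  turn_neq : forall x, turn x != x;
  across_neq : forall x, across x != x;
  along_acrossC : forall x, along (across x) = across (along x);
  flag_nonempty : 0 < #|flag|;
  flag_connected : forall x y,
    connect (fun a b => [|| b == along a, b == turn a | b == across a]) x y
}.

Section Cells.
Variable M : smap.

Definition vertex_of (x : M) : {set M} :=
  [set y | connect (fun a b => (b == turn a) || (b == across a)) x y].
Definition edge_of (x : M) : {set M} :=
  [set y | connect (fun a b => (b == along a) || (b == across a)) x y].
Definition face_of (x : M) : {set M} :=
  [set y | connect (fun a b => (b == along a) || (b == turn a)) x y].

Definition vertices : {set {set M}} := [set vertex_of x | x : M].
Definition edges : {set {set M}} := [set edge_of x | x : M].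
Definition faces : {set {set M}} := [set face_of x | x : M].
Definition corners : {set {set M}} := [set [set x; turn x] | x : M].

Definition semi_edges : {set {set M}} :=
  [set edge_of x | x : M & along x == across x].

Definition is_proper : Prop := semi_edges = set0.

(* Each edge-end at a vertex accounts for two flags of that vertex, and each
   side of a face for two flags of that face; this includes semi-edges, which
   have one end at their vertex and count once around their face. *)
Definition has_type (k l : nat) : Prop :=
  forall x : M, #|vertex_of x| = (2 * k)%N /\ #|face_of x| = (2 * l)%N.

(* In the cell decomposition of the surface the dangling end of a semi-edge is
   a further point, hence the summand [#|semi_edges|]. *)
Definition euler_char : int :=
  ((#|vertices| + #|semi_edges|)%:Z - #|edges|%:Z + #|faces|%:Z)%R.

Definition orientable : Prop :=
  exists o : M -> bool, forall x,
    [/\ o (along x) = ~~ o x, o (turn x) = ~~ o x & o (across x) = ~~ o x].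

(* The sphere and the projective plane, as they appear in the classification
   of closed surfaces by orientability and Euler characteristic. *)
Definition on_sphere : Prop := orientable /\ euler_char = 2%R.
Definition on_projective_plane : Prop := ~ orientable /\ euler_char = 1%R.

Definition map_aut : {set {perm M}} :=
  [set f : {perm M} | [forall x, [&& f (along x) == along (f x),
                                     f (turn x) == turn (f x)
                                   & f (across x) == across (f x)]]].

Definition fully_regular : Prop :=
  [transitive map_aut, on [set: M] | 'P].

(* A colouring of the edges is a function on flags that is constant on edges;
   [true] is shaded.  Two edges that are consecutive around a vertex, or around
   a face, are those of two flags [x] and [turn x]. *)
Definition alternate (c : M -> bool) : Prop :=
  forall x, [/\ c (along x) = c x, c (across x) = c x & c (turn x) = ~~ c x].

Definition colour_aut (c : M -> bool) : {set {perm M}} :=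
  [set f in map_aut | [forall x, c (f x) == c x]].

Definition edge_biregular (c : M -> bool) : Prop :=
  alternate c /\
  forall A B : {set M}, A \in corners -> B \in corners ->
    exists! f : {perm M}, f \in colour_aut c /\ f @: A = B.

Definition edge_orbits (c : M -> bool) : {set {set {set M}}} :=
  [set orbit ('P^*)%act (colour_aut c) e | e in edges].
Definition semi_edge_orbits (c : M -> bool) : {set {set {set M}}} :=
  [set O in edge_orbits c | O \subset semi_edges].

Definition semistar (v : nat) : Prop :=
  [/\ #|vertices| = 1, edges = semi_edges & #|edges| = v].

(* The underlying graph is a cycle with [n] vertices [v i] and [n] edges [e i],
   where [e i] joins [v i] to [v (i + 1 mod n)]; it has no semi-edges.  A vertex
   is an end of an edge when the two share a flag. *)
Definition embedded_cycle (n : nat) : Prop :=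
  is_proper /\
  exists v e : 'I_n -> {set M},
    [/\ injective v, v @: [set: 'I_n] = vertices,
        injective e, e @: [set: 'I_n] = edges &
        forall i j, ~~ [disjoint v j & e i] = (j == i) || (j == ordS i)].

Definition embedded_even_cycle : Prop :=
  exists n, [/\ 0 < n, ~~ odd n & embedded_cycle n].

End Cells.

Section Dual.
Variable M : smap.

Fact dual_comm (x : M) : across (along x) = along (across x).
Proof. by rewrite along_acrossC. Qed.

Fact dual_connected (x y : M) :
  connect (fun a b => [|| b == across a, b == turn a | b == along a]) x y.
Proof.
rewrite (eq_connect (e' := fun a b => [|| b == along a, b == turn a
                                        | b == across a])) => [|a b].
  exact: flag_connected.
by rewrite orbC -orbA orbCA.
Qed.

Definition dual : smap :=
  SMap (@acrossK M) (@turnK M) (@alongK M) (@across_neq M) (@turn_neq M)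
       (@along_neq M) dual_comm (flag_nonempty M) dual_connected.

End Dual.

(* Attaching one semi-edge in each corner.  A flag [x] is cut into the part
   [(x, true)] next to its old edge and the part [(x, false)] next to the
   semi-edge attached in the corner of [x] and [turn x]. *)
Section Attach.
Variable M : smap.

Definition attach_along (p : M * bool) : M * bool :=
  (if p.2 then along p.1 else turn p.1, p.2).
Definition attach_turn (p : M * bool) : M * bool := (p.1, ~~ p.2).
Definition attach_across (p : M * bool) : M * bool :=
  (if p.2 then across p.1 else turn p.1, p.2).

Fact attach_alongK : involutive attach_along.
Proof. by case=> x [] /=; rewrite /attach_along /= ?alongK ?turnK. Qed.
Fact attach_turnK : involutive attach_turn.
Proof. by case=> x b; rewrite /attach_turn /= negbK. Qed.
Fact attach_acrossK : involutive attach_across.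
Proof. by case=> x [] /=; rewrite /attach_across /= ?acrossK ?turnK. Qed.
Fact attach_along_neq p : attach_along p != p.
Proof.
by case: p => x [] /=; rewrite xpair_eqE negb_and ?along_neq ?turn_neq.
Qed.
Fact attach_turn_neq p : attach_turn p != p.
Proof. by case: p => x []; rewrite xpair_eqE andbF. Qed.
Fact attach_across_neq p : attach_across p != p.
Proof.
by case: p => x [] /=; rewrite xpair_eqE negb_and ?across_neq ?turn_neq.
Qed.
Fact attach_comm p :
  attach_along (attach_across p) = attach_across (attach_along p).
Proof.
by case: p => x []; rewrite /attach_along /attach_across /= ?along_acrossC.
Qed.
Fact attach_nonempty : 0 < #|{: M * bool}|.
Proof. by rewrite card_prod card_bool muln_gt0 flag_nonempty. Qed.

Fact attach_connected p q :
  connect (fun a b => [|| b == attach_along a, b == attach_turn a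
                        | b == attach_across a]) p q.
Proof.
set e := (fun a b => _).
have e0 a : connect e a (attach_along a) by apply: connect1; rewrite /e eqxx.
have e1 a : connect e a (attach_turn a).
  by apply: connect1; rewrite /e eqxx !orbT.
have e2 a : connect e a (attach_across a).
  by apply: connect1; rewrite /e eqxx !orbT.
have flip x b b' : connect e (x, b) (x, b').
  by have := e1 (x, b); case: b b' => [] [].
have lift x y : connect e (x, true) (y, true).
  have /connectP[s] := flag_connected x y.
  elim: s x => [|z s IHs] x /=; first by move=> _ ->.
  case/andP=> exz path_s y_last.
  apply: connect_trans (IHs z path_s y_last).
  case/or3P: exz => /eqP->; [exact: (e0 (x, true)) | | exact: (e2 (x, true))].
  apply: connect_trans (flip x true false) _.
  apply: connect_trans (flip _ false true).
  exact: (e0 (x, false)).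
case: p q => x b [y b'].
exact: connect_trans (flip x b true)
  (connect_trans (lift x y) (flip y true b')).
Qed.

Definition attach : smap :=
  SMap attach_alongK attach_turnK attach_acrossK attach_along_neq
       attach_turn_neq attach_across_neq attach_comm attach_nonempty
       attach_connected.

End Attach.

Definition map_iso (M N : smap) (f : M -> N) : Prop :=
  bijective f /\
  forall x, [/\ f (along x) = along (f x), f (turn x) = turn (f x)
              & f (across x) = across (f x)].

(* The coloured map [M] is, up to isomorphism, the map [M0] with one semi-edge
   attached in each corner, the edges of [M0] having colour [b] and the attached
   semi-edges the other colour. *)
Definition attached_from (M0 M : smap) (c : M -> bool) : Prop :=
  exists (f : attach M0 -> M) (b : bool),
    map_iso f /\ forall p : M0 * bool, c (f p) = if p.2 then b else ~~ b.

(* In both definitions [S] is [on_sphere] or [on_projective_plane]. *)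
Definition supports_regular (S : smap -> Prop) (k l : nat) : Prop :=
  exists M : smap, [/\ S M, is_proper M, fully_regular M & has_type M k l].

Definition supports_one_orbit_biregular (S : smap -> Prop) (k l : nat) : Prop :=
  exists (M : smap) (c : M -> bool),
    [/\ S M, edge_biregular c, #|semi_edge_orbits c| = 1 & has_type M k l].

(* Main.v *)
Require Import Defs.
From mathcomp Require Import all_boot all_order all_algebra all_fingroup.
From mathcomp Require Import fingraph zify.

Set Implicit Arguments.
Unset Strict Implicit.
Unset Printing Implicit Defensive.

(* Vertices, edges and faces are orbits of two involutions without fixed points,
   so they are counted by the orders of the rotations.  If all edges are
   semi-edges the map is a single such orbit, hence a dihedral torsor on the
   sphere.  If one colour consists of semi-edges, these can be removed: the flags
   of the other colour form a map on which the colour-preserving automorphisms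
   are transitive.  If there are no semi-edges and the type is (2k, 2l), a
   positive Euler characteristic V - E + F = |M| (1/4k - 1/4 + 1/4l) forces k = 1
   or l = 1, and a 2-valent map is a cycle, of even length because its edges
   alternate in colour. *)

(** * Orbits of two involutions *)

(** The surface enters only through flags and three involutions without fixed points, so every claim
    becomes one about orders of products of two involutions. Automorphisms are rigid: one image
    determines them. Hence transitivity on corners amounts to transitivity on the flags of each
    colour, and one semi-edge forces its whole colour to consist of semi-edges. The existence half
    needs concrete maps. The families of valency 2 are built on the 2n flags of an n-gon: on the
    sphere two n-gons are glued along their boundaries, on the projective plane opposite boundary
    points of a single one are identified, which needs n even. The Platonic maps and their antipodal
    quotients are Cayley tables of permutation groups, where right multiplications glue the flags
    and left multiplications are the automorphisms; all conditions are then finite and decided by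
    computation. In the classification of cycles, sphere and projective plane are treated together
    by working up to the side of the band around the cycle, since the walk may return on the other
    side. *)

Section IterOrder.
Variables (T : finType) (f : T -> T) (f_inj : injective f).

Lemma iter_mod_order i x : iter (i %% order f x) f x = iter i f x.
Proof.
rewrite {2}(divn_eq i (order f x)) addnC iterD; congr (iter _ f _).
elim: (i %/ _) => // m IHm.
by rewrite mulSn iterD -IHm iter_order.
Qed.

Lemma iter_fixed_order i x : (iter i f x == x) = (order f x %| i).
Proof.
rewrite -iter_mod_order; have lt_o := ltn_pmod i (order_gt0 f x).
rewrite /dvdn; apply/eqP/eqP=> [e|->] //.
by rewrite -(findex_iter lt_o) e findex0.
Qed.

Lemma order_eq n x : 0 < n -> iter n f x = x ->
  (forall i, 0 < i < n -> iter i f x != x) -> order f x = n.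
Proof.
move=> n_gt0 /eqP; rewrite iter_fixed_order => on min.
have := dvdn_leq n_gt0 on; rewrite leq_eqVlt => /orP[/eqP//|lt_on].
by have := min (order f x); rewrite order_gt0 lt_on iter_order // eqxx => /(_ isT).
Qed.

End IterOrder.

Section DihedralOrbits.
Variables (T : finType) (a b : T -> T).
Hypotheses (aK : involutive a) (bK : involutive b).

Definition dorbit (x : T) : {set T} :=
  [set y | connect (fun u v => (v == a u) || (v == b u)) x y].

Lemma dorbit_refl x : x \in dorbit x.
Proof. by rewrite inE connect0. Qed.

Lemma dorbit_sub (C : {set T}) x :
  x \in C -> (forall y, y \in C -> a y \in C) ->
  (forall y, y \in C -> b y \in C) -> dorbit x \subset C.
Proof.
move=> Cx Ca Cb; apply/subsetP=> y; rewrite inE => /connectP[p].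
elim: p x Cx => [|z p IHp] x Cx /= => [_ -> //|/andP[xz]].
by apply: IHp; case/orP: xz => /eqP->; [apply: Ca | apply: Cb].
Qed.

Lemma dorbit_a x y : y \in dorbit x -> a y \in dorbit x.
Proof.
by rewrite !inE => /connect_trans; apply; rewrite connect1 ?eqxx.
Qed.

Lemma dorbit_b x y : y \in dorbit x -> b y \in dorbit x.
Proof.
by rewrite !inE => /connect_trans; apply; rewrite connect1 ?eqxx ?orbT.
Qed.

Lemma dorbit_sym x y : (y \in dorbit x) = (x \in dorbit y).
Proof.
rewrite !inE; apply: sym_connect_sym => u v.
by rewrite -(inv_eq aK) -(inv_eq bK) !(eq_sym u).
Qed.

Lemma dorbit_eq x y : y \in dorbit x -> dorbit y = dorbit x.
Proof.
have sub u v : v \in dorbit u -> dorbit v \subset dorbit u.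
  by move=> uv; apply: dorbit_sub => // z; [apply: dorbit_a | apply: dorbit_b].
by move=> xy; apply/eqP; rewrite eqEsubset !sub // dorbit_sym.
Qed.

Lemma card_dorbits (D : {set T}) n :
  (forall x, x \in D -> a x \in D) -> (forall x, x \in D -> b x \in D) ->
  (forall x, x \in D -> #|dorbit x| = n) ->
  #|D| = #|[set dorbit x | x in D]| * n.
Proof.
move=> Da Db Dn; apply: card_uniform_partition.
  by move=> A /imsetP[x Dx ->]; apply: Dn.
have sub x : x \in D -> dorbit x \subset D by move=> Dx; apply: dorbit_sub.
apply/and3P; split.
- rewrite eqEsubset; apply/andP; split; apply/subsetP=> x.
    by case/bigcupP=> A /imsetP[y Dy ->]; apply/subsetP/sub.
  by move=> Dx; apply/bigcupP; exists (dorbit x); rewrite ?imset_f ?dorbit_refl.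
- apply/trivIsetP=> A B /imsetP[x Dx ->] /imsetP[y Dy ->]; apply: contraR.
  case/pred0Pn=> z /andP[/= zx zy].
  by rewrite -(dorbit_eq zx) -(dorbit_eq zy).
- by apply/imsetP=> [[x Dx e0]]; have := dorbit_refl x; rewrite -e0 inE.
Qed.

Lemma card_dorbits_all n :
  (forall x, #|dorbit x| = n) -> #|T| = #|[set dorbit x | x : T]| * n.
Proof.
move=> Tn; rewrite -cardsT (@card_dorbits setT n) //; congr (#|pred_of_set _| * n).
by apply/setP=> A; apply/imsetP/imsetP=> -[x _ ->]; exists x; rewrite ?inE.
Qed.

Hypotheses (a_neq : forall x, a x != x) (b_neq : forall x, b x != x).

Let t := b \o a.

Lemma dihedral_rot_inj : injective t.
Proof. exact: inj_comp (inv_inj bK) (inv_inj aK). Qed.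

Lemma a_rot x : a (t x) = finv t (a x).
Proof. by apply: dihedral_rot_inj; rewrite (f_finv dihedral_rot_inj) /t /= aK bK. Qed.

(* A fixed point of a reflection of the orbit yields one of [a] or of [b] in
   the middle of the rotation path. *)
Lemma rot_neq_a i x : iter i t x != a x.
Proof.
elim/ltn_ind: i x => -[|[|i]] IHi x; first by rewrite eq_sym.
  exact: b_neq.
rewrite iterS iterSr -(f_finv dihedral_rot_inj (a x)) (inj_eq dihedral_rot_inj) -a_rot.
exact: IHi.
Qed.

(** The right-hand side is stable under both reflections: [a] exchanges its two halves, and so does
    [b], which is [a] followed by the rotation [t]. The halves are disjoint by [rot_neq_a], which
    gives the factor 2 in [card_dorbit]. *)
Lemma dorbitE x :
  dorbit x = [set y | fconnect t x y] :|: [set y | fconnect t x (a y)].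
Proof.
have tC := fconnect_sym dihedral_rot_inj.
apply/eqP; rewrite eqEsubset; apply/andP; split.
  apply: dorbit_sub => [|y|y]; rewrite !inE ?connect0 //.
    by rewrite aK orbC.
  case/orP=> xy; apply/orP; [right | left].
    apply: connect_trans xy _; rewrite tC.
    by apply: connect1; rewrite /= /t /= aK bK.
  apply: connect_trans xy _; rewrite -{2}(aK y).
  exact: (@fconnect1 _ t (a y)).
have sub i : iter i t x \in dorbit x.
  by elim: i => [|i IHi]; rewrite ?dorbit_refl //= dorbit_b ?dorbit_a.
apply/subsetP=> y; rewrite 3!inE => /orP[] /iter_findex.
  by move=> <-.
by move=> ay; rewrite -(aK y) dorbit_a // -ay.
Qed.

Lemma card_dorbit x : #|dorbit x| = 2 * order t x.
Proof.
rewrite dorbitE cardsU.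
have ->: #|[set y | fconnect t x (a y)]| = order t x.
  rewrite /order -(card_image (inv_inj aK) (fconnect t x)).
  apply: eq_card => y; rewrite !inE -[in RHS](aK y) mem_image //.
  exact: inv_inj.
have ->: #|[set y | fconnect t x y]| = order t x.
  by apply: eq_card => y; rewrite !inE.
rewrite (_ : _ :&: _ = set0) ?cards0 ?subn0 ?mul2n ?addnn //.
apply/setP=> y; rewrite !inE; apply/negP=> /andP[].
rewrite (fconnect_sym dihedral_rot_inj) => /connect_trans xy /xy /iter_findex /eqP.
by rewrite (negPf (rot_neq_a _ _)).
Qed.

Lemma dorbitP x y :
  y \in dorbit x -> exists i, y = iter i t x \/ y = a (iter i t x).
Proof.
rewrite dorbitE !inE => /orP[] /iter_findex e; [exists (findex t x y); left|].
  by [].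
by exists (findex t x (a y)); right; rewrite e aK.
Qed.

Lemma odd_order_rot (c : T -> bool) x :
  (forall y, c (t y) = ~~ c y) -> ~~ odd (order t x).
Proof.
move=> ct; have ci i y : c (iter i t y) = odd i (+) c y.
  by elim: i => // i IHi; rewrite iterS ct IHi addNb.
have := ci (order t x) x; rewrite (iter_order dihedral_rot_inj).
by case: (odd _) (c x) => [] [].
Qed.

(* With a single orbit the two reflections act simply transitively, so that an
   element is determined by its coordinates with respect to [x]. *)
Lemma dorbit_translate x y :
  (forall z, z \in dorbit x) ->
  exists f : T -> T, [/\ f x = y, forall z, f (a z) = a (f z)
                                & forall z, f (b z) = b (f z)].
Proof.
move=> xT; have oxy : order t x = order t y.
  have := card_dorbit x; rewrite -(dorbit_eq (xT y)) card_dorbit; lia.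
pose f z := if fconnect t x z then iter (findex t x z) t y
            else a (iter (findex t x (a z)) t y).
have fi i : f (iter i t x) = iter i t y.
  rewrite /f fconnect_iter -[in findex _ _ _](iter_mod_order dihedral_rot_inj) findex_iter.
    by rewrite oxy (iter_mod_order dihedral_rot_inj).
  by rewrite ltn_mod order_gt0.
have fai i : f (a (iter i t x)) = a (iter i t y).
  rewrite {1}/f aK; case: ifP => [xa|_]; last first.
    by have := fi i; rewrite /f fconnect_iter => ->.
  have /iter_findex/eqP : fconnect t (iter i t x) (a (iter i t x)).
    by apply: connect_trans xa; rewrite (fconnect_sym dihedral_rot_inj) fconnect_iter.
  by rewrite (negPf (rot_neq_a _ _)).
have bt z : b (t z) = a z by rewrite /t /= bK.
(* Applying [b] undoes one rotation step before reflecting by [a]; the added full period keeps the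
   exponent positive. *)
have bS i z : b (iter (i + order t z) t z) = a (iter (i + (order t z).-1) t z).
  by rewrite -[order t z]prednK ?order_gt0 // addnS iterS bt.
have pi i z : iter (i + order t z) t z = iter i t z.
  by rewrite iterD iter_order //; apply: dihedral_rot_inj.
exists f; split=> [|z|z]; first exact: (fi 0).
  by have [i [] ->] := dorbitP (xT z); rewrite ?aK ?fai fi ?aK.
have [i [] ->] := dorbitP (xT z); first by rewrite -pi bS fai fi oxy -bS.
by rewrite fai -![b (a _)]/(iter i.+1 t _) fi.
Qed.

(** Rotations and reflections of [x] never meet, so parity of words is well defined on the orbit.
    This supplies the orientation in [all_semi_sphere]. *)
Lemma dorbit_bipartite x (o := fconnect t x) :
  (forall z, z \in dorbit x) ->
  forall z, o (a z) = ~~ o z /\ o (b z) = ~~ o z.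
Proof.
move=> xT; have oa z : o (a z) = ~~ o z.
  have := xT z; rewrite dorbitE !inE -!/(o _).
  have [xz _|_ //] := boolP (o z); apply/negP=> xaz.
  have /iter_findex/eqP : fconnect t z (a z).
    by apply: connect_trans xaz; rewrite (fconnect_sym dihedral_rot_inj).
  by rewrite (negPf (rot_neq_a _ _)).
move=> z; split=> //; rewrite -oa /o -{1}(aK z) -/(t (a z)).
by rewrite -same_fconnect1_r //; apply: dihedral_rot_inj.
Qed.

End DihedralOrbits.

Lemma dorbit_morph (T T' : finType) (a b : T -> T) (a' b' : T' -> T') f x :
  (forall y, f (a y) = a' (f y)) -> (forall y, f (b y) = b' (f y)) ->
  dorbit a' b' (f x) = f @: dorbit a b x.
Proof.
move=> fa fb; apply/eqP; rewrite eqEsubset; apply/andP; split.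
  apply: dorbit_sub; first by rewrite imset_f ?dorbit_refl.
    by move=> _ /imsetP[y xy ->]; rewrite -fa imset_f ?dorbit_a.
  by move=> _ /imsetP[y xy ->]; rewrite -fb imset_f ?dorbit_b.
rewrite sub_imset_pre; apply: dorbit_sub => [|y|y].
- by rewrite [_ \in _]inE dorbit_refl.
- by rewrite [y \in _]inE [a y \in _]inE fa; apply: dorbit_a.
- by rewrite [y \in _]inE [b y \in _]inE fb; apply: dorbit_b.
Qed.

(** * Automorphisms and cells *)

Section Flags.
Variable M : smap.
Implicit Types (x y : M) (p q : {perm M}).

Lemma flag_ind (P : M -> Prop) x :
  P x -> (forall y, P y -> [/\ P (along y), P (turn y) & P (across y)]) ->
  forall y, P y.
Proof.
move=> Px step y; have /connectP[p] := flag_connected x y.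
elim: p x Px => [|z p IHp] x Px /= => [_ -> //|/andP[xz]]; apply: IHp.
by have [? ? ?] := step _ Px; case/or3P: xz => /eqP->.
Qed.

Definition flag_morph (f : M -> M) :=
  forall x, [/\ f (along x) = along (f x), f (turn x) = turn (f x)
              & f (across x) = across (f x)].

Lemma map_autP p : reflect (flag_morph p) (p \in map_aut M).
Proof.
rewrite inE; apply: (iffP forallP) => pM x.
  by have /and3P[/eqP ? /eqP ? /eqP] := pM x.
by have [-> -> ->] := pM x; rewrite !eqxx.
Qed.

(** The image is closed under the gluing maps, hence everything by connectedness; a surjection of a
    finite set onto itself is bijective. *)
Lemma flag_morph_aut (f : M -> M) : flag_morph f -> exists2 p, p \in map_aut M & p =1 f.
Proof.
move=> fM; have /card_gt0P[x0 _] := flag_nonempty M.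
have f_onto y : y \in codom f.
  move: y; apply: (@flag_ind _ (f x0)) => [|_ /codomP[x ->]].
    exact: codom_f.
  by have [<- <- <-] := fM x; rewrite !codom_f.
have f_inj : injective f.
  by apply/injectiveP/card_uniqP; rewrite size_codom; apply: eq_card => y; rewrite f_onto.
exists (perm f_inj); last exact: permE.
by apply/map_autP=> x; rewrite !permE.
Qed.

Lemma map_aut_eq p q x : p \in map_aut M -> q \in map_aut M -> p x = q x -> p = q.
Proof.
move=> /map_autP pM /map_autP qM pq; apply/permP.
apply: (@flag_ind (fun y => p y = q y) x) => // y e.
by have [-> -> ->] := pM y; have [-> -> ->] := qM y; rewrite e.
Qed.

Lemma map_aut1 : 1%g \in map_aut M.
Proof. by apply/map_autP=> x; rewrite !perm1. Qed.

Lemma map_autM p q : p \in map_aut M -> q \in map_aut M -> (p * q)%g \in map_aut M.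
Proof.
move=> /map_autP pM /map_autP qM; apply/map_autP=> x; rewrite !permM.
by have [-> -> ->] := pM x; have [-> -> ->] := qM (p x).
Qed.

Lemma map_autV p : p \in map_aut M -> (p^-1)%g \in map_aut M.
Proof.
move/map_autP=> pM; apply/map_autP=> x.
have [e1 e2 e3] := pM (p^-1%g x).
by split; apply: (@perm_inj _ p); rewrite permKV ?e1 ?e2 ?e3 permKV.
Qed.

Lemma fully_regularP :
  fully_regular M <-> forall x y, exists2 p, p \in map_aut M & p x = y.
Proof.
split=> [/imsetP[x _ orbx] y z|tr].
  have get u : exists2 p, p \in map_aut M & p x = u.
    have := in_setT u; rewrite orbx.
    by case/imsetP=> p pM ->; exists p.
  have [p pM <-] := get y; have [q qM <-] := get z.
  exists (p^-1 * q)%g; first by rewrite map_autM ?map_autV.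
  by rewrite permM permK.
have /card_gt0P[x0 _] := flag_nonempty M.
apply/imsetP; exists x0; rewrite ?inE //; apply/eqP.
rewrite eqEsubset subsetT andbT; apply/subsetP=> y _.
by have [p pM <-] := tr x0 y; apply/imsetP; exists p.
Qed.

(* The set of flags reached from [x] by automorphisms is closed under the
   gluing maps as soon as it contains the neighbours of [x]. *)
Lemma fully_regular_neighbours x :
  (exists2 f, flag_morph f & f x = along x) ->
  (exists2 f, flag_morph f & f x = turn x) ->
  (exists2 f, flag_morph f & f x = across x) -> fully_regular M.
Proof.
move=> [f0 m0 e0] [f1 m1 e1] [f2 m2 e2].
have [p0 a0 E0] := flag_morph_aut m0; have [p1 a1 E1] := flag_morph_aut m1.
have [p2 a2 E2] := flag_morph_aut m2.
have get : forall y, exists2 p, p \in map_aut M & p x = y.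
  apply: (@flag_ind _ x) => [|_ [p pM <-]].
    by exists 1%g; rewrite ?perm1 ?map_aut1.
  have [<- <- <-] := (map_autP _ pM) x.
  split; [exists (p0 * p)%g|exists (p1 * p)%g|exists (p2 * p)%g];
    by rewrite ?map_autM // permM ?E0 ?E1 ?E2 ?e0 ?e1 ?e2.
apply/fully_regularP=> y z.
have [p pM <-] := get y; have [q qM <-] := get z.
exists (p^-1 * q)%g; first by rewrite map_autM ?map_autV.
by rewrite permM permK.
Qed.

End Flags.

(** * Colour-preserving automorphisms *)

Section Colours.
Variables (M : smap) (c : M -> bool).
Implicit Types (x y : M) (p q : {perm M}).

Lemma colour_autP p :
  reflect (p \in map_aut M /\ forall x, c (p x) = c x) (p \in colour_aut c).
Proof.
apply: (iffP setIdP) => -[pM pc]; split=> //.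
  by move=> x; apply/eqP/(forallP pc).
by apply/forallP=> x; apply/eqP.
Qed.

Lemma alternate_colour_aut p x :
  alternate c -> p \in map_aut M -> c (p x) = c x -> p \in colour_aut c.
Proof.
move=> alt pM pc; apply/colour_autP; split=> //.
apply: (@flag_ind _ _ x) => // y e.
have [-> -> ->] := (map_autP _ pM) y.
by have [-> -> ->] := alt y; have [-> -> ->] := alt (p y); rewrite e.
Qed.

(** A corner holds one flag of each colour, so moving corners while preserving colours is the same
    as moving flags of equal colour. Uniqueness comes for free from [map_aut_eq]. *)
Lemma edge_biregularP :
  edge_biregular c <->
  alternate c /\
  forall x y, c x = c y -> exists2 p, p \in colour_aut c & p x = y.
Proof.
split=> -[alt tr]; split=> //.
  move=> x y xy.
  have [p [[pC pxy] _]] := tr [set x; turn x] [set y; turn y]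
      (imset_f _ (erefl _)) (imset_f _ (erefl _)).
  exists p => //; have : p x \in [set y; turn y] by rewrite -pxy imset_f ?set21.
  rewrite !inE => /orP[/eqP//|/eqP pxt].
  have [_ /(_ x)] := colour_autP _ pC; rewrite pxt xy; have [_ _ ->] := alt y.
  by case: (c y).
move=> A B /imsetP[x _ ->] /imsetP[y _ ->].
(* The target corner is renamed after its flag of the colour of [x]. *)
have [y' y'E cy] : exists2 y', [set y; turn y] = [set y'; turn y'] & c x = c y'.
  have [/eqP|nxy] := boolP (c x == c y); first by exists y.
  exists (turn y); first by rewrite turnK setUC.
  by have [_ _ ->] := alt y; case: (c x) (c y) nxy => [] [].
rewrite {}y'E; have [p pC pxy] := tr _ _ cy.
have [pM pc] := colour_autP _ pC.
exists p; split; first split=> //.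
  by rewrite imsetU1 imset_set1 pxy; have [_ -> _] := (map_autP _ pM) x; rewrite pxy.
move=> q [qC qxy]; have [qM qc] := colour_autP _ qC.
apply: (map_aut_eq (x := x)) => //; rewrite pxy.
have : q x \in [set y'; turn y'] by rewrite -qxy imset_f ?set21.
rewrite !inE => /orP[/eqP//|/eqP qxt]; move: (qc x).
by rewrite qxt cy; have [_ _ ->] := alt y'; case: (c y').
Qed.

Lemma fully_regular_biregular :
  alternate c -> fully_regular M -> edge_biregular c.
Proof.
move=> alt /fully_regularP tr; apply/edge_biregularP; split=> // x y xy.
have [p pM pxy] := tr x y; exists p => //.
by apply: (alternate_colour_aut (x := x)); rewrite ?pxy.
Qed.

End Colours.

(** * Counting cells and the Euler characteristic *)

Section Counting.
Variable M : smap.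
Implicit Types (x y : M) (p q : {perm M}).

Lemma card_vertex_of x : #|vertex_of x| = 2 * order (@across M \o @turn M) x.
Proof.
exact: (card_dorbit (@turnK M) (@acrossK M) (@turn_neq M) (@across_neq M)).
Qed.

Lemma card_face_of x : #|face_of x| = 2 * order (@turn M \o @along M) x.
Proof.
exact: (card_dorbit (@alongK M) (@turnK M) (@along_neq M) (@turn_neq M)).
Qed.

Lemma card_edge_of x : #|edge_of x| = if along x == across x then 2 else 4.
Proof.
rewrite (card_dorbit (@alongK M) (@acrossK M) (@along_neq M) (@across_neq M)).
have t_inj := dihedral_rot_inj (@alongK M) (@acrossK M).
have e : (across (along x) == x) = (along x == across x).
  by rewrite (inv_eq (@acrossK M)) eq_sym.
suff ->: order (@across M \o @along M) x = if along x == across x then 1 else 2.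
  by case: ifP.
case: ifP => xs; apply: (order_eq t_inj) => //=; try lia.
- by apply/eqP; rewrite e.
- by rewrite along_acrossC !alongK acrossK.
- by case=> [|[|i]] // _; rewrite /= e xs.
Qed.

Lemma mem_edge_of x y : y \in edge_of x -> edge_of y = edge_of x.
Proof. exact: (dorbit_eq (@alongK M) (@acrossK M)). Qed.

Lemma edge_of_refl x : x \in edge_of x.
Proof. exact: dorbit_refl. Qed.

Lemma edge_of_semi x y :
  y \in edge_of x -> (along y == across y) = (along x == across x).
Proof.
move=> xy; have := card_edge_of x; rewrite -(mem_edge_of xy) card_edge_of.
by do 2 case: ifP.
Qed.

Lemma edge_in_semi x : (edge_of x \in semi_edges M) = (along x == across x).
Proof.
apply/imsetP/idP=> [[y] | xs]; last by exists x; rewrite ?inE.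
by rewrite inE => ys xy; rewrite (edge_of_semi (x := y)) // -xy edge_of_refl.
Qed.

Lemma along_semi x : (along (along x) == across (along x)) = (along x == across x).
Proof. by rewrite -along_acrossC (inj_eq (inv_inj (@alongK M))). Qed.

Lemma across_semi x : (along (across x) == across (across x)) = (along x == across x).
Proof. by rewrite along_acrossC (inj_eq (inv_inj (@acrossK M))). Qed.

Lemma card_semi_edges : #|[set x : M | along x == across x]| = #|semi_edges M| * 2.
Proof.
rewrite (@card_dorbits _ _ _ (@alongK M) (@acrossK M) _ 2) //.
- by move=> x; rewrite !inE along_semi.
- by move=> x; rewrite !inE across_semi.
- by move=> x; rewrite inE => xs; have := card_edge_of x; rewrite xs.
Qed.

(* Four times the usual formula; only the flags on proper edges are counted,
   since a semi-edge and its dangling end cancel out. *)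
Lemma euler_charP n :
  euler_char M = n%:Z%R <->
  4 * n + #|[set x : M | along x != across x]| = 4 * (#|vertices M| + #|faces M|).
Proof.
set D := [set x | _]; pose full := [set edge_of x | x in D].
have cD : #|D| = #|full| * 4.
  apply: (card_dorbits (@alongK M) (@acrossK M)) => x; rewrite inE => xs.
  - by rewrite inE along_semi.
  - by rewrite inE across_semi.
  - by have := card_edge_of x; rewrite (negPf xs).
have edgesE : edges M = semi_edges M :|: full.
  apply/setP=> A; rewrite in_setU; apply/imsetP/orP=> [[x _ ->]|[] /imsetP[x xD ->]].
  - rewrite edge_in_semi; case: (boolP (along x == across x)) => xs; [by left | right].
    by rewrite imset_f // inE.
  - by exists x.
  - by exists x.
have disj : semi_edges M :&: full = set0.
  apply/setP=> A; rewrite !in_set; apply/negP=> /andP[semiA] /imsetP[x].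
  by rewrite inE => xs AE; move: semiA; rewrite AE edge_in_semi (negPf xs).
rewrite /euler_char edgesE cardsU disj cards0 cD.
by move: #|vertices M| #|semi_edges M| #|full| #|faces M| => v s e f; lia.
Qed.

Lemma card_vertices k l : has_type M k l -> #|M| = #|vertices M| * (2 * k).
Proof.
move=> Mkl; apply: (card_dorbits_all (@turnK M) (@acrossK M)) => x.
by have [] := Mkl x.
Qed.

Lemma card_faces k l : has_type M k l -> #|M| = #|faces M| * (2 * l).
Proof.
move=> Mkl; apply: (card_dorbits_all (@alongK M) (@turnK M)) => x.
by have [] := Mkl x.
Qed.

Lemma is_properP : is_proper M <-> forall x, along x != across x.
Proof.
split=> [Mp x|Mp]; first by rewrite -edge_in_semi Mp inE.
by apply/setP=> A; rewrite inE; apply/imsetP=> -[x]; rewrite inE (negPf (Mp x)).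
Qed.

Lemma card_proper_flags : is_proper M -> #|[set x : M | along x != across x]| = #|M|.
Proof.
move/is_properP=> Mp; rewrite -cardsT; apply: eq_card => x; by rewrite !inE Mp.
Qed.

Lemma vertex_of_aut p x : p \in map_aut M -> vertex_of (p x) = p @: vertex_of x.
Proof. by move/map_autP=> pM; apply: dorbit_morph => y; have [] := pM y. Qed.

Lemma edge_of_aut p x : p \in map_aut M -> edge_of (p x) = p @: edge_of x.
Proof. by move/map_autP=> pM; apply: dorbit_morph => y; have [] := pM y. Qed.

Lemma face_of_aut p x : p \in map_aut M -> face_of (p x) = p @: face_of x.
Proof. by move/map_autP=> pM; apply: dorbit_morph => y; have [] := pM y. Qed.

Lemma regular_type x :
  fully_regular M ->
  has_type M (order (@across M \o @turn M) x) (order (@turn M \o @along M) x).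
Proof.
move/fully_regularP=> tr y; have [p pM <-] := tr x y.
rewrite vertex_of_aut // face_of_aut // !card_imset; try exact: perm_inj.
by rewrite card_vertex_of card_face_of.
Qed.

Section AllSemi.
Hypothesis allS : forall x, along x = across x.

Lemma all_semi_vertex x y : y \in vertex_of x.
Proof.
move: y; apply: (@flag_ind _ _ x); first exact: dorbit_refl.
by move=> y xy; rewrite allS; split; by [apply: dorbit_a | apply: dorbit_b].
Qed.

Lemma all_semi_face x y : y \in face_of x.
Proof.
move: y; apply: (@flag_ind _ _ x); first exact: dorbit_refl.
by move=> y xy; rewrite -allS; split; by [apply: dorbit_b | apply: dorbit_a].
Qed.

Lemma card_cover1 (S : M -> {set M}) :
  (forall x y, y \in S x) -> #|[set S x | x : M]| = 1.
Proof.
have /card_gt0P[x0 _] := flag_nonempty M => ST.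
apply/eqP/cards1P; exists setT; apply/setP=> A; rewrite inE.
apply/imsetP/eqP=> [[x _ ->]|->]; last exists x0 => //.
  by apply/setP=> y; rewrite ST inE.
by apply/setP=> y; rewrite ST inE.
Qed.

Lemma all_semi_edges : edges M = semi_edges M.
Proof.
apply/setP=> A; apply/imsetP/imsetP=> -[x xs ->]; exists x => //.
by rewrite inE allS.
Qed.

Lemma all_semi_semistar n : #|M| = 2 * n -> semistar M n.
Proof.
move=> Mn; split; [exact: card_cover1 all_semi_vertex | exact: all_semi_edges|].
have := card_semi_edges; rewrite -all_semi_edges => e.
suff : #|M| = #|edges M| * 2 by lia.
by rewrite -e -cardsT; apply: eq_card => x; rewrite !inE allS eqxx.
Qed.

Lemma all_semi_sphere : on_sphere M.
Proof.
have /card_gt0P[x0 _] := flag_nonempty M.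
split.
  exists (fconnect (@across M \o @turn M) x0) => x.
  have [||||oa ob] := dorbit_bipartite _ _ _ _ (all_semi_vertex x0) x.
  - exact: turnK.
  - exact: acrossK.
  - exact: turn_neq.
  - exact: across_neq.
  - by rewrite allS.
(* One vertex, one face and no flag on a full edge: 4 * 2 + 0 = 4 * (1 + 1). *)
apply/(euler_charP 2).
rewrite (card_cover1 all_semi_vertex) (card_cover1 all_semi_face).
rewrite (_ : [set x : M | _] = set0) ?cards0 //.
by apply/setP=> x; rewrite !inE allS eqxx.
Qed.

Lemma all_semi_regular : fully_regular M.
Proof.
apply/fully_regularP=> x y.
have [f [fx fa fb]] := dorbit_translate (@turnK M) (@acrossK M)
  (@turn_neq M) (@across_neq M) y (all_semi_vertex x).
have [|p pM pf] := @flag_morph_aut M f; first by move=> z; rewrite !allS.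
by exists p; rewrite ?pf.
Qed.

End AllSemi.

Lemma semistar_all_semi n : semistar M n -> forall x, along x = across x.
Proof.
case=> _ eS _ x; apply/eqP; rewrite -edge_in_semi -eS.
exact: imset_f.
Qed.

End Counting.

(** * Type and edge orbits of an edge-biregular map *)

Section BiregularOrbits.
Variables (M : smap) (c : M -> bool).
Hypothesis bireg : edge_biregular c.
Implicit Types (x y : M) (p q : {perm M}).

Let alt : alternate c. Proof. by case: bireg. Qed.

Let aut x y : c x = c y -> exists2 p, p \in colour_aut c & p x = y.
Proof. by have [_] := (edge_biregularP c).1 bireg; apply. Qed.

Lemma biregular_type : exists k l, [/\ 0 < k, 0 < l & has_type M (2 * k) (2 * l)].
Proof.
have /card_gt0P[x0 _] := flag_nonempty M.
have even2 n : 0 < n -> ~~ odd n -> exists2 m, 0 < m & n = 2 * m.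
  by move=> n0 nodd; exists n./2; lia.
have [||k k0 ek] := even2 (order (@across M \o @turn M) x0); first exact: order_gt0.
  apply: (@odd_order_rot _ _ _ (@turnK M) (@acrossK M) c) => y /=.
  by have [_ _ <-] := alt y; have [_ -> _] := alt (turn y).
have [||l l0 el] := even2 (order (@turn M \o @along M) x0); first exact: order_gt0.
  apply: (@odd_order_rot _ _ _ (@alongK M) (@turnK M) c) => y /=.
  by have [<- _ _] := alt y; have [_ _ ->] := alt (along y).
exists k, l; split=> // y.
suff same z : c z = c x0 ->
    #|vertex_of z| = 2 * (2 * k) /\ #|face_of z| = 2 * (2 * l).
  (* A flag of the other colour shares its vertex and its face with its [turn], which has the colour
     of [x0]. *)
  have [/same//|cy] := eqVneq (c y) (c x0).
  rewrite -[vertex_of y](dorbit_eq (@turnK M) (@acrossK M) (dorbit_a (dorbit_refl _ _ y))).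
  rewrite -[face_of y](dorbit_eq (@alongK M) (@turnK M) (dorbit_b (dorbit_refl _ _ y))).
  by apply: same; have [_ _ ->] := alt y; case: (c y) (c x0) cy => [] [].
move=> czx; have [p pC <-] := aut (esym czx); have [pM _] := colour_autP _ _ pC.
rewrite vertex_of_aut // face_of_aut // !card_imset; try exact: perm_inj.
by rewrite card_vertex_of card_face_of ek el.
Qed.

Let E b := [set edge_of y | y in [set y | c y == b]].

Let mem_colour x y : y \in edge_of x -> c y = c x.
Proof.
have /subsetP sub : edge_of x \subset [set y | c y == c x].
  by apply: dorbit_sub => [|z|z]; rewrite !inE //; have [e1 e2 _] := alt z; rewrite ?e1 ?e2.
by move/sub; rewrite inE => /eqP.
Qed.

Let edge_orbitE x :
  action.orbit ('P^*)%act (colour_aut c) (edge_of x) = E (c x).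
Proof.
apply/setP=> A; apply/imsetP/imsetP=> [[p pC ->]|[y]].
  have [pM pc] := colour_autP _ _ pC.
  exists (p x); first by rewrite inE pc.
  by rewrite edge_of_aut.
rewrite inE => /eqP cy ->; have [p pC <-] := aut (esym cy).
by exists p => //; rewrite edge_of_aut //; case/colour_autP: pC.
Qed.

Lemma semi_edge_colour x y : c x = c y -> along x = across x -> along y = across y.
Proof.
move/aut=> [p /colour_autP[/map_autP pM _] <-] xs.
by have [<- _ <-] := pM x; rewrite xs.
Qed.

(** The edge orbits are the two colour classes [E b], and a class containing one semi-edge contains
    only semi-edges. So it suffices to count the colours seen on semi-edges. *)
Lemma card_semi_edge_orbits :
  #|semi_edge_orbits c| = #|[set c x | x : M & along x == across x]|.
Proof.
have /card_gt0P[x0 _] := flag_nonempty M.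
have E_inj : injective E.
  move=> b b' bb'; have [x cx] : exists x, c x = b.
    have [e|n] := eqVneq (c x0) b; first by exists x0.
    by exists (turn x0); have [_ _ ->] := alt x0; move: n; case: (c x0); case: (b).
  have : edge_of x \in E b' by rewrite -bb' imset_f // inE cx.
  case/imsetP=> y; rewrite inE => /eqP <- xy.
  by rewrite -cx; apply: mem_colour; rewrite -xy edge_of_refl.
rewrite -(card_imset _ E_inj); apply: eq_card => O; rewrite inE.
apply/andP/imsetP=> [[]|[b /imsetP[x]]].
  case/imsetP=> _ /imsetP[x _ ->] ->; rewrite edge_orbitE => sub.
  exists (c x) => //; apply: imset_f; rewrite inE -edge_in_semi.
  by apply: (subsetP sub); apply: imset_f; rewrite inE.
rewrite inE => /eqP xs -> ->; split.
  by rewrite -edge_orbitE; do 2 apply: imset_f.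
apply/subsetP=> _ /imsetP[y yx ->]; rewrite edge_in_semi; apply/eqP.
by apply: semi_edge_colour xs; move: yx; rewrite inE => /eqP.
Qed.

End BiregularOrbits.

(** * Attaching and removing semi-edges, duality *)

Lemma dorbitC (T : finType) (a b : T -> T) x : dorbit a b x = dorbit b a x.
Proof. by apply/setP=> y; rewrite !inE; apply: eq_connect => u v; rewrite orbC. Qed.

Section AttachOrbits.
Variables (T : finType) (g h : T -> T).
Let a (p : T * bool) := (if p.2 then g p.1 else h p.1, p.2).
Let b (p : T * bool) := (p.1, ~~ p.2).

(** Since [b] passes freely between the halves, the orbit is that of [g] and [h] times [bool]. With
    [h] the corner reflection, [g := across] gives the vertices of [attach] and [g := along] its
    faces. *)
Lemma card_dorbit_attach p : #|dorbit a b p| = 2 * #|dorbit g h p.1|.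
Proof.
suff ->: dorbit a b p = setX (dorbit g h p.1) [set: bool].
  by rewrite cardsX cardsT card_bool mulnC.
have inX q : (q \in setX (dorbit g h p.1) [set: bool]) = (q.1 \in dorbit g h p.1).
  by case: q => x c; rewrite in_setX in_setT andbT.
apply/eqP; rewrite eqEsubset; apply/andP; split.
  apply: dorbit_sub => [|q|q]; rewrite !inX ?dorbit_refl //=.
  by case: (q.2); [apply: dorbit_a | apply: dorbit_b].
have flip x c c' : (x, c) \in dorbit a b p -> (x, c') \in dorbit a b p.
  move=> xp; have [<-//|] := eqVneq c c'.
  by have := dorbit_b xp; rewrite /b /=; case: c c' {xp} => [] [].
pose C := [set x | (x, true) \in dorbit a b p].
have inC x : (x \in C) = ((x, true) \in dorbit a b p) by rewrite inE.
have /subsetP sub : dorbit g h p.1 \subset C.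
  apply: dorbit_sub => [|x|x]; rewrite !inC.
  - by apply: (flip _ p.2); case: (p) => x c; apply: dorbit_refl.
  - by move/dorbit_a.
  - by move/(flip _ _ false)/dorbit_a/(flip _ _ true).
apply/subsetP=> -[x c]; rewrite inX => /sub; rewrite inC => xC.
exact: flip xC.
Qed.

End AttachOrbits.

Section AttachMap.
Variable M : smap.

Lemma attach_type k l : has_type M k l -> has_type (attach M) (2 * k) (2 * l).
Proof.
move=> Mkl p; have [ek el] := Mkl p.1.
have vE (N : smap) (y : N) : vertex_of y = dorbit (@across N) (@turn N) y.
  exact: dorbitC.
split; first by rewrite vE [LHS]card_dorbit_attach -[dorbit _ _ _]vE ek.
by rewrite [LHS]card_dorbit_attach -[dorbit _ _ _]/(face_of p.1) el.
Qed.

Lemma attach_euler k l n : is_proper M -> has_type M k l ->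
  euler_char M = n%:Z%R -> euler_char (attach M) = n%:Z%R.
Proof.
move=> Mp Mkl /euler_charP; rewrite card_proper_flags // => e; apply/euler_charP.
have /card_gt0P[x0 _] := flag_nonempty M.
have [kx lx] := Mkl x0.
have k_gt0 : 0 < #|vertex_of x0| by apply/card_gt0P; exists x0; apply: dorbit_refl.
have l_gt0 : 0 < #|face_of x0| by apply/card_gt0P; exists x0; apply: dorbit_refl.
have cA : #|attach M| = 2 * #|M| by rewrite card_prod card_bool mulnC.
have cV := card_vertices Mkl; have cV' := card_vertices (attach_type Mkl).
have cF := card_faces Mkl; have cF' := card_faces (attach_type Mkl).
(* The number of flags, the valency and the face length all double, so the numbers of vertices and
   faces are unchanged. *)
have -> : #|vertices (attach M)| = #|vertices M| by nia.
have -> : #|faces (attach M)| = #|faces M| by nia.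
rewrite -e; congr (_ + _).
rewrite (_ : [set p | _] = setX [set: M] [set true]).
  by rewrite cardsX cardsT cards1 muln1.
apply/setP=> -[x b]; rewrite !inE /along /across /= xpair_eqE eqxx andbT.
by case: b; rewrite /= ?eqxx // (is_properP M).1.
Qed.

Lemma attach_orientable : orientable M <-> orientable (attach M).
Proof.
split=> -[o oP].
  exists (fun p : attach M => o p.1 (+) p.2) => -[x b] /=.
  have [o0 o1 o2] := oP x.
  by split; case: b; rewrite /= ?o0 ?o1 ?o2; case: (o x).
exists (fun x => o (x, true)) => x.
have [o0 o1 o2] := oP (x, true); split=> //.
(* Crossing a corner of [M] means going around the attached semi-edge by [turn], [along], [turn]:
   three sign changes. *)
have [o0' _ _] := oP (x, false); have [_ o1' _] := oP (turn x, true).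
rewrite -[o (turn x, true)]negbK -o1' -o1; exact: canLR negbK o0'.
Qed.

Lemma attach_sphere k l :
  is_proper M -> has_type M k l -> on_sphere M -> on_sphere (attach M).
Proof.
move=> Mp Mkl [/attach_orientable ? ?]; split=> //.
exact: (attach_euler (n := 2) Mp Mkl).
Qed.

Lemma attach_projective_plane k l :
  is_proper M -> has_type M k l -> on_projective_plane M ->
  on_projective_plane (attach M).
Proof.
move=> Mp Mkl [No e]; split; first by move/attach_orientable.
exact: (attach_euler (n := 1) Mp Mkl).
Qed.

Lemma attach_biregular :
  fully_regular M -> edge_biregular (fun p : attach M => p.2).
Proof.
move/fully_regularP=> tr; apply/edge_biregularP; split=> // -[x b] [y _] /= <-.
have [p /map_autP pM pxy] := tr x y.
have [|q qM qp] := @flag_morph_aut (attach M) (fun z => (p z.1, z.2)).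
  move=> [z b']; have [e0 e1 e2] := pM z.
  by split; case: b'; rewrite /= /attach_along /attach_turn /attach_across /= ?e0 ?e1 ?e2.
exists q; last by rewrite qp /= pxy.
by apply: (@alternate_colour_aut (attach M) _ q (x, b)); rewrite ?qp.
Qed.

Lemma attach_semi_edge_orbits :
  is_proper M -> fully_regular M ->
  #|semi_edge_orbits (fun p : attach M => p.2)| = 1.
Proof.
move=> /is_properP Mp /attach_biregular bireg; rewrite card_semi_edge_orbits //.
have /card_gt0P[x0 _] := flag_nonempty M.
apply/eqP/cards1P; exists false; apply/setP=> b; rewrite inE.
apply/imsetP/eqP=> [[[x []]]|->].
- by rewrite inE /= xpair_eqE (negPf (Mp x)).
- by [].
- by exists (x0, false); rewrite ?inE.
Qed.

End AttachMap.

Lemma supports_attach (S : smap -> Prop) k l :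
  (forall M, is_proper M -> has_type M k l -> S M -> S (attach M)) ->
  supports_regular S k l -> supports_one_orbit_biregular S (2 * k) (2 * l).
Proof.
move=> SA [M [SM Mp Mr Mkl]]; exists (attach M), snd; split.
- exact: SA.
- exact: attach_biregular.
- exact: attach_semi_edge_orbits.
- exact: attach_type.
Qed.

Section DualMap.
Variable M : smap.

Lemma dual_type k l : has_type M k l -> has_type (dual M) l k.
Proof.
move=> Mkl x; have [ek el] := Mkl x.
by split; [rewrite -el | rewrite -ek]; congr #|pred_of_set _|; apply: dorbitC.
Qed.

Lemma dual_proper : is_proper M -> is_proper (dual M).
Proof. by move/is_properP=> Mp; apply/is_properP=> x; rewrite eq_sym; apply: Mp. Qed.

Lemma dual_regular : fully_regular M -> fully_regular (dual M).
Proof.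
move/fully_regularP=> tr; apply/fully_regularP=> x y.
have [p /map_autP pM pxy] := tr x y; exists p => //.
by apply/map_autP=> z; have [? ? ?] := pM z.
Qed.

Lemma dual_orientable : orientable (dual M) <-> orientable M.
Proof. by split=> -[o oP]; exists o => x; have [? ? ?] := oP x. Qed.

Lemma dual_biregular (c : M -> bool) :
  edge_biregular c -> edge_biregular (c : dual M -> bool).
Proof.
case/edge_biregularP=> alt tr; apply/edge_biregularP; split.
  by move=> x; have [? ? ?] := alt x.
move=> x y /tr[p /colour_autP[/map_autP pM pc] pxy]; exists p => //.
apply/colour_autP; split=> //.
by apply/map_autP=> z; have [? ? ?] := pM z.
Qed.

Lemma dual_euler n : euler_char M = n%:Z%R <-> euler_char (dual M) = n%:Z%R.
Proof.
have cV : #|vertices (dual M)| = #|faces M|.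
  by congr #|pred_of_set _|; apply: eq_imset => x; apply: dorbitC.
have cF : #|faces (dual M)| = #|vertices M|.
  by congr #|pred_of_set _|; apply: eq_imset => x; apply: dorbitC.
have cE : #|[set x : dual M | along x != across x]| = #|[set x : M | along x != across x]|.
  by apply: eq_card => x; rewrite !inE eq_sym.
by split=> /euler_charP e; apply/euler_charP; lia.
Qed.

Lemma dual_sphere : on_sphere M -> on_sphere (dual M).
Proof.
by move=> [/dual_orientable o e]; split=> //; apply: (dual_euler 2).1.
Qed.

Lemma dual_projective_plane : on_projective_plane M -> on_projective_plane (dual M).
Proof.
by move=> [No e]; split; [move/dual_orientable | apply: (dual_euler 1).1].
Qed.

End DualMap.

Lemma supports_dual (S : smap -> Prop) k l :
  (forall M, S M -> S (dual M)) -> supports_regular S k l -> supports_regular S l k.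
Proof.
move=> SD [M [SM Mp Mr Mkl]]; exists (dual M); split; first exact: SD.
- exact: dual_proper.
- exact: dual_regular.
- exact: dual_type.
Qed.

(* With one orbit of semi-edges, [M] is recovered from the map on its flags of
   the other colour, where the corner reflection passes around a semi-edge. *)
Section Detach.
Variables (M : smap) (c : M -> bool) (b : bool).
Hypotheses (bireg : edge_biregular c)
  (semiE : forall x, (along x == across x) = (c x != b)).

Let alt : alternate c. Proof. by case: bireg. Qed.
Let U := {x : M | c x == b}.

Fact detach_subproof (f : M -> M) (u : U) :
  (forall x, c (f x) = c x) -> c (f (val u)) == b.
Proof. by move=> fc; rewrite fc (valP u). Qed.

Let colour_along x : c (along x) = c x. Proof. by have [] := alt x. Qed.
Let colour_across x : c (across x) = c x. Proof. by have [] := alt x. Qed.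
Let colour_turn x : c (turn x) = ~~ c x. Proof. by have [] := alt x. Qed.
Let colour_round x : c (turn (along (turn x))) = c x.
Proof. by rewrite colour_turn colour_along colour_turn negbK. Qed.

Let lift f (fc : forall x, c (f x) = c x) (u : U) : U :=
  Sub (f (val u)) (detach_subproof u fc).
Let d_along := lift colour_along.
Let d_across := lift colour_across.
Let d_turn := lift colour_round.

Fact d_alongK : involutive d_along.
Proof. by move=> u; apply: val_inj; rewrite /= alongK. Qed.
Fact d_acrossK : involutive d_across.
Proof. by move=> u; apply: val_inj; rewrite /= acrossK. Qed.
Fact d_turnK : involutive d_turn.
Proof. by move=> u; apply: val_inj; rewrite /= turnK alongK turnK. Qed.
Fact d_along_neq u : d_along u != u.
Proof. by rewrite -val_eqE along_neq. Qed.
Fact d_across_neq u : d_across u != u.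
Proof. by rewrite -val_eqE across_neq. Qed.
Fact d_turn_neq u : d_turn u != u.
Proof. by rewrite -val_eqE /= (inv_eq (@turnK M)) along_neq. Qed.
Fact d_comm u : d_along (d_across u) = d_across (d_along u).
Proof. by apply: val_inj; rewrite /= along_acrossC. Qed.
Fact d_nonempty : 0 < #|{: U}|.
Proof.
have /card_gt0P[x0 _] := flag_nonempty M.
have [x cx] : exists x, c x == b.
  have [e|n] := eqVneq (c x0) b; first by exists x0; apply/eqP.
  by exists (turn x0); rewrite colour_turn; move: n; case: (c x0); case: (b).
by apply/card_gt0P; exists (Sub x cx).
Qed.

Let back x := if c x == b then x else turn x.

(** Paths of [M] are projected by [back], which picks the flag of colour [b] in a corner: a [turn]
    becomes stationary, and a step along or across a semi-edge becomes [d_turn]. *)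
Fact d_connected u v :
  connect (fun p q => [|| q == d_along p, q == d_turn p | q == d_across p]) u v.
Proof.
pose e (p q : U) := [|| q == d_along p, q == d_turn p | q == d_across p].
rewrite -[connect _ u v]/(connect e u v).
pose near x := exists2 w : U, val w = back x & connect e u w.
suff H : forall x, near x.
  by have [w wv] := H (val v); rewrite /back (valP v) in wv; rewrite -(val_inj wv).
apply: (@flag_ind _ near (val u)).
  by exists u; rewrite ?connect0 // /back (valP u).
have step w w' : connect e u w -> e w w' -> connect e u w'.
  by move=> uw ww'; apply: connect_trans uw (connect1 ww').
move=> x [w wx uw]; split.
- move: wx; rewrite /near /back colour_along; case: ifP => cx wx.
    by exists (d_along w); [rewrite /= wx | apply: step uw _; rewrite /e eqxx].
  exists (d_turn w); last by apply: step uw _; rewrite /e eqxx orbT.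
  by rewrite /= wx turnK.
- exists w => //; rewrite wx /back colour_turn turnK.
  by case: (c x) (b) => [] [].
- move: wx; rewrite /near /back colour_across; case: ifP => cx wx.
    by exists (d_across w); [rewrite /= wx | apply: step uw _; rewrite /e eqxx !orbT].
  exists (d_turn w); last by apply: step uw _; rewrite /e eqxx orbT.
  have /eqP <- : along x == across x by rewrite semiE cx.
  by rewrite /= wx turnK.
Qed.

Definition detach : smap :=
  SMap d_alongK d_turnK d_acrossK d_along_neq d_turn_neq d_across_neq d_comm
       d_nonempty d_connected.

(** A colour-preserving automorphism commutes with the composite defining [d_turn], so it restricts
    to the flags of colour [b], on which biregularity gives transitivity. *)
Lemma detach_regular : fully_regular detach.
Proof.
have [_ tr] := (edge_biregularP c).1 bireg.
apply/fully_regularP=> u v.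
have [|p /colour_autP[/map_autP pM pc] puv] := tr (val u) (val v).
  by rewrite (eqP (valP u)) (eqP (valP v)).
have [|q qM qp] := @flag_morph_aut detach (lift pc); last first.
  by exists q => //; rewrite qp; apply: val_inj.
move=> w; have [e0 _ e2] := pM (val w).
split; apply: val_inj => //=.
have [_ e1 _] := pM (val w).
have [_ -> _] := pM (along (turn (val w))); have [-> _ _] := pM (turn (val w)).
by rewrite e1.
Qed.

Lemma attached_detach : attached_from detach c.
Proof.
pose f (p : attach detach) : M := if p.2 then val p.1 else turn (val p.1).
have cf p : c (f p) = if p.2 then b else ~~ b.
  by rewrite /f; case: (p.2); rewrite ?colour_turn (eqP (valP p.1)).
exists f, b; split=> //; split.
  have bb x : c (back x) == b.
    by rewrite /back; case: ifP => //; rewrite colour_turn; case: (c x) (b) => [] [].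
  pose g (x : M) : U * bool := (Sub (back x) (bb x), c x == b).
  exists (g : M -> attach detach) => [[u b']|x].
    congr pair; last by rewrite cf; case: b' (b) => [] [].
    apply: val_inj; rewrite /= /back cf /f /=.
    have nb : (~~ b == b) = false by case: (b).
    by case: b'; rewrite /= ?eqxx // nb turnK.
  by rewrite /f /g /= /back; case: (c x == b); rewrite ?turnK.
move=> [u b']; split.
- by case: b'; rewrite /f //= turnK.
- by case: b'; rewrite /f //= turnK.
- case: b'; rewrite /f //= turnK.
  by apply/eqP; rewrite semiE colour_turn (eqP (valP u)); case: (b).
Qed.

End Detach.

Lemma one_orbit_attached (M : smap) (c : M -> bool) :
  edge_biregular c -> #|semi_edge_orbits c| = 1 ->
  exists M0 : smap, fully_regular M0 /\ attached_from M0 c.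
Proof.
move=> bireg; rewrite card_semi_edge_orbits // => /eqP/cards1P[b cS].
(* Here [b] is the colour of the semi-edges; the map that remains after removing them has colour
   [~~ b]. *)
have semiE x : (along x == across x) = (c x != ~~ b).
  apply/idP/idP=> [xs|].
    have : c x \in [set b] by rewrite -cS imset_f // inE.
    by rewrite inE => /eqP->; case: (b).
  move=> cx; have : b \in [set b] by rewrite inE.
  rewrite -cS => /imsetP[y]; rewrite inE => /eqP ys by_.
  apply/eqP/(semi_edge_colour bireg _ ys).
  by rewrite -by_; case: (c x) (b) cx => [] [].
exists (detach bireg semiE); split; [exact: detach_regular|exact: attached_detach].
Qed.

Lemma two_orbits_all_semi (M : smap) (c : M -> bool) :
  edge_biregular c -> #|semi_edge_orbits c| = 2 ->
  forall x : M, along x = across x.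
Proof.
move=> bireg; rewrite card_semi_edge_orbits // => c2 x.
have : c x \in [set c x | x : M & along x == across x].
  suff -> : [set c x | x : M & along x == across x] = setT by rewrite inE.
  by apply/eqP; rewrite eqEcard subsetT cardsT card_bool c2.
case/imsetP=> y; rewrite inE => /eqP ys cxy.
exact: (semi_edge_colour bireg (esym cxy) ys).
Qed.

(** * Semistars and cycles on the sphere and the projective plane *)

Section Ring.
Variable n : nat.
Hypothesis n_gt0 : 0 < n.
Implicit Types p q : 'I_n * bool.

(** The 2n flags of an n-gon: [(i, true)] lies at corner [i] on the side towards [i + 1], and
    [(i, false)] on the side towards [i - 1], cyclically. *)
Definition ring_along p := if p.2 then (ordS p.1, false) else (ord_pred p.1, true).
Definition ring_turn p := (p.1, ~~ p.2).

Lemma ring_alongK : involutive ring_along.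
Proof. by case=> i []; rewrite /ring_along /= ?ordSK ?ord_predK. Qed.
Lemma ring_turnK : involutive ring_turn.
Proof. by case=> i b; rewrite /ring_turn /= negbK. Qed.
Lemma ring_along_neq p : ring_along p != p.
Proof. by case: p => i []; rewrite xpair_eqE andbF. Qed.
Lemma ring_turn_neq p : ring_turn p != p.
Proof. by case: p => i []; rewrite xpair_eqE andbF. Qed.

Lemma ring_connected p q : q \in dorbit ring_along ring_turn p.
Proof.
pose z := (Ordinal n_gt0, true).
suff H r : r \in dorbit ring_along ring_turn z.
  by rewrite (dorbit_eq ring_alongK ring_turnK (H p)).
have H i (lt_in : i < n) : (Ordinal lt_in, true) \in dorbit ring_along ring_turn z.
  elim: i lt_in => [|i IHi] lt_in.
    by rewrite (_ : (_, true) = z) ?dorbit_refl //; congr pair; apply: val_inj.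
  have := dorbit_b (dorbit_a (IHi (ltnW lt_in))).
  rewrite /ring_turn /ring_along /= (_ : ordS _ = Ordinal lt_in) //.
  by apply: val_inj; rewrite /= modn_small.
case: r => [[i lt_in] []]; first exact: H.
exact: (dorbit_b (H i lt_in)).
Qed.

Definition ring_rot := ring_turn \o ring_along.

Lemma order_ring_rot p : order ring_rot p = n.
Proof.
have := card_dorbit ring_alongK ring_turnK ring_along_neq ring_turn_neq p.
have -> : dorbit ring_along ring_turn p = setT.
  by apply/setP=> q; rewrite ring_connected inE.
by rewrite cardsT card_prod card_ord card_bool mulnC -/ring_rot; lia.
Qed.

Lemma ring_rot_inj : injective ring_rot.
Proof. exact: dihedral_rot_inj ring_alongK ring_turnK. Qed.

Lemma iter_ring_rot i p : (iter i ring_rot p == p) = (n %| i).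
Proof. by rewrite (iter_fixed_order ring_rot_inj) order_ring_rot. Qed.

Lemma ring_nonempty : 0 < #|{: 'I_n * bool}|.
Proof. by rewrite card_prod card_ord card_bool muln_gt0 n_gt0. Qed.

Section Semistar.

Fact star_connected p q :
  connect (fun a b => [|| b == ring_along a, b == ring_turn a | b == ring_along a]) p q.
Proof.
have := ring_connected p q; rewrite inE; apply: connect_sub => u v uv.
by rewrite connect1 // orbA uv.
Qed.

Definition star_map : smap :=
  SMap ring_alongK ring_turnK ring_alongK ring_along_neq ring_turn_neq
       ring_along_neq (fun p => erefl) ring_nonempty star_connected.

Lemma star_semistar : semistar star_map n.
Proof. by apply: all_semi_semistar => //; rewrite card_prod card_ord card_bool mulnC. Qed.

(** Both flags on the side from corner [i] to corner [i + 1] get the parity of [i + 1]; [n] even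
    makes this consistent at the wrap-around. *)
Lemma star_biregular :
  ~~ odd n -> edge_biregular (fun p : star_map => odd p.1 (+) p.2).
Proof.
move=> n_even; apply: fully_regular_biregular; last exact: all_semi_regular.
have oS (i : 'I_n) : odd (ordS i) = ~~ odd i.
  rewrite /=; have [e|lt_in] := eqVneq i.+1 n.
    by rewrite e modnn -[odd i]negbK -[~~ odd i]/(odd i.+1) e (negPf n_even).
  by rewrite modn_small //; have := ltn_ord i; lia.
have oP (i : 'I_n) : odd (ord_pred i) = ~~ odd i.
  by rewrite -{2}(ord_predK i) oS negbK.
have H (p : star_map) : odd (ring_along p).1 (+) (ring_along p).2 = odd p.1 (+) p.2.
  by case: p => i []; rewrite /ring_along ?oS ?oP /=; case: (odd i).
move=> p; split; [exact: H | exact: H |].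
by rewrite /= addbN.
Qed.

End Semistar.

Section SphereCycle.

(** Two n-gons, told apart by the last component and glued along their boundaries, which become the
    equator. *)
Let sc_along (x : 'I_n * bool * bool) := (ring_along x.1, x.2).
Let sc_turn (x : 'I_n * bool * bool) := (ring_turn x.1, x.2).
Let sc_across (x : 'I_n * bool * bool) := (x.1, ~~ x.2).

Fact sc_alongK : involutive sc_along.
Proof. by case=> p b; rewrite /sc_along /= ring_alongK. Qed.
Fact sc_turnK : involutive sc_turn.
Proof. by case=> p b; rewrite /sc_turn /= ring_turnK. Qed.
Fact sc_acrossK : involutive sc_across.
Proof. by case=> p b; rewrite /sc_across /= negbK. Qed.
Fact sc_along_neq x : sc_along x != x.
Proof. by case: x => p b; rewrite xpair_eqE negb_and ring_along_neq. Qed.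
Fact sc_turn_neq x : sc_turn x != x.
Proof. by case: x => p b; rewrite xpair_eqE negb_and ring_turn_neq. Qed.
Fact sc_across_neq x : sc_across x != x.
Proof. by case: x => p []; rewrite xpair_eqE andbF. Qed.
Fact sc_nonempty : 0 < #|{: 'I_n * bool * bool}|.
Proof. by rewrite card_prod muln_gt0 ring_nonempty card_bool. Qed.
Fact sc_connected x y :
  connect (fun a b => [|| b == sc_along a, b == sc_turn a | b == sc_across a]) x y.
Proof.
pose e a b := [|| b == sc_along a, b == sc_turn a | b == sc_across a].
rewrite -[connect _ x y]/(connect e x y).
pose C := [set p | connect e x (p, x.2)].
have CP p : (p \in C) = connect e x (p, x.2) by rewrite inE.
have step p q : p \in C -> e (p, x.2) (q, x.2) -> q \in C.
  by rewrite !CP => xp /connect1; apply: connect_trans.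
have /subsetP sub : dorbit ring_along ring_turn x.1 \subset C.
  apply: dorbit_sub => [|p pC|p pC].
  - by rewrite CP; case: (x) => ? ?; apply: connect0.
  - by apply: step pC _; rewrite /e /sc_along /= eqxx.
  - by apply: step pC _; rewrite /e /sc_turn /= eqxx orbT.
have := sub _ (ring_connected x.1 y.1); rewrite CP => xy.
apply: connect_trans xy _; have [e2|n2] := eqVneq x.2 y.2.
  by rewrite e2; case: (y) => ? ?; apply: connect0.
apply/connect1/or3P/Or33; case: (y) n2 => p b /=; rewrite xpair_eqE eqxx.
by case: b (x.2) => [] [].
Qed.

Definition sphere_cycle : smap :=
  SMap sc_alongK sc_turnK sc_acrossK sc_along_neq sc_turn_neq sc_across_neq
       (fun x => erefl) sc_nonempty sc_connected.

Lemma sphere_cycle_proper : is_proper sphere_cycle.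
Proof. by apply/is_properP=> -[p []]; rewrite xpair_eqE andbF. Qed.

Lemma sphere_cycle_regular : fully_regular sphere_cycle.
Proof.
apply/fully_regularP=> x y.
have [f [fx fa fb]] := dorbit_translate ring_alongK ring_turnK
  ring_along_neq ring_turn_neq y.1 (ring_connected x.1).
have [|p pM pf] := @flag_morph_aut sphere_cycle (fun z => (f z.1, z.2 (+) (x.2 (+) y.2))).
  by move=> z; rewrite /= /sc_along /sc_turn /sc_across /= fa fb addNb.
exists p => //; rewrite pf fx addbA addbb.
by case: (y).
Qed.

Lemma sphere_cycle_type : has_type sphere_cycle 2 n.
Proof.
pose x : sphere_cycle := (Ordinal n_gt0, true, true).
have := regular_type x sphere_cycle_regular.
have -> : order (@across sphere_cycle \o @turn sphere_cycle) x = 2.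
  apply: order_eq => //; first exact: dihedral_rot_inj sc_turnK sc_acrossK.
  by case=> [|[|i]].
have it i : iter i (@turn sphere_cycle \o @along sphere_cycle) x =
    (iter i ring_rot x.1, x.2).
  by elim: i => // i /= ->.
have -> // : order (@turn sphere_cycle \o @along sphere_cycle) x = n.
apply: order_eq => //; first exact: dihedral_rot_inj sc_alongK sc_turnK.
  by apply/eqP; rewrite it xpair_eqE iter_ring_rot dvdnn.
move=> i /andP[i0 lt_in]; rewrite it xpair_eqE iter_ring_rot negb_and.
by rewrite gtnNdvd.
Qed.

Lemma sphere_cycle_sphere : on_sphere sphere_cycle.
Proof.
split.
  exists (fun x : sphere_cycle => x.1.2 (+) x.2) => -[[i b] d].
  by rewrite /= /ring_along /=; case: b d => [] [].
apply/(euler_charP sphere_cycle 2); rewrite card_proper_flags; last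
  exact: sphere_cycle_proper.
have := card_vertices sphere_cycle_type; have := card_faces sphere_cycle_type.
by rewrite !card_prod card_ord card_bool; nia.
Qed.

End SphereCycle.

Section ProjectiveCycle.
Hypothesis n_even : ~~ odd n.

(* The antipodal map of the [2n]-gon of flags, which identifies it to a disc
   whose opposite boundary points are glued. *)
Let pc_across := iter n./2 ring_rot.

Let pc_across2 p : pc_across (pc_across p) = p.
Proof.
rewrite /pc_across -iterD addnn (_ : _.*2 = n); last by lia.
by apply/eqP; rewrite iter_ring_rot.
Qed.

Let iter_colour i p : (iter i ring_rot p).2 = p.2.
Proof. by elim: i => //= i <-; case: (iter _ _ _) => j []. Qed.

(** The dihedral relation t^i a t^i = a. For half a turn, which is its own inverse, it says that the
    antipodal map commutes with the reflection. *)
Let rot_along i p : iter i ring_rot (ring_along (iter i ring_rot p)) = ring_along p.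
Proof.
elim: i p => // i IHi p; rewrite iterSr iterS -[RHS]IHi; congr (iter _ _ _).
by rewrite /ring_rot /= ring_alongK ring_turnK.
Qed.

Let rot_turn i p : iter i ring_rot (ring_turn (iter i ring_rot p)) = ring_turn p.
Proof.
elim: i p => // i IHi p; rewrite iterSr iterS -[RHS]IHi; congr (iter _ _ _).
by rewrite /ring_rot /= ring_turnK ring_alongK.
Qed.

Let pc_turnC p : ring_turn (pc_across p) = pc_across (ring_turn p).
Proof. by rewrite -[LHS]pc_across2 /pc_across rot_turn. Qed.

Fact pc_across_neq p : pc_across p != p.
Proof. by rewrite iter_ring_rot gtnNdvd; lia. Qed.

Fact pc_comm p : ring_along (pc_across p) = pc_across (ring_along p).
Proof. by rewrite -[LHS]pc_across2 /pc_across rot_along. Qed.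

Fact pc_connected p q :
  connect (fun a b => [|| b == ring_along a, b == ring_turn a | b == pc_across a]) p q.
Proof.
have := ring_connected p q; rewrite inE; apply: connect_sub => u v uv.
by rewrite connect1 // orbA uv.
Qed.

Definition projective_cycle : smap :=
  SMap ring_alongK ring_turnK pc_across2 ring_along_neq ring_turn_neq
       pc_across_neq pc_comm ring_nonempty pc_connected.

Lemma projective_cycle_proper : is_proper projective_cycle.
Proof.
apply/is_properP=> p; apply/eqP=> /(congr1 snd) /=.
by rewrite iter_colour; case: p => i [].
Qed.

Lemma projective_cycle_regular : fully_regular projective_cycle.
Proof.
apply/fully_regularP=> x y.
have [f [fx fa fb]] := dorbit_translate ring_alongK ring_turnK
  ring_along_neq ring_turn_neq y (ring_connected x).
have [|p pM pf] := @flag_morph_aut projective_cycle f; last by exists p; rewrite ?pf.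
move=> z; split=> //=; rewrite /pc_across.
by elim: (n./2) => //= i <-; rewrite /ring_rot /= fb fa.
Qed.

Lemma projective_cycle_type : has_type projective_cycle 2 n.
Proof.
pose x : projective_cycle := (Ordinal n_gt0, true).
have := regular_type x projective_cycle_regular.
rewrite [X in has_type _ _ X]order_ring_rot.
have -> // : order (@across projective_cycle \o @turn projective_cycle) x = 2.
apply: order_eq => //; first exact: dihedral_rot_inj ring_turnK pc_across2.
  by rewrite /= pc_turnC pc_across2 ring_turnK.
case=> [|[|i]] // _; apply/eqP=> /(congr1 snd) /=.
by rewrite iter_colour.
Qed.

(** Here [across] is a power of the rotation, a word of even length in [along] and [turn]; an
    orientation would be both kept and reversed by it. *)
Lemma projective_cycle_projective_plane : on_projective_plane projective_cycle.
Proof.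
split.
  case=> o oP; pose x : projective_cycle := (Ordinal n_gt0, true).
  have [_ _] := oP x.
  suff -> i : o (iter i ring_rot x) = o x by case: (o x).
  elim: i => // i <-; rewrite iterS.
  have [o0 _ _] := oP (iter i ring_rot x).
  have [_ o1 _] := oP (ring_along (iter i ring_rot x)).
  by rewrite [LHS]o1 [X in ~~ X]o0 negbK.
apply/(euler_charP projective_cycle 1); rewrite card_proper_flags; last
  exact: projective_cycle_proper.
have := card_vertices projective_cycle_type; have := card_faces projective_cycle_type.
by rewrite !card_prod card_ord card_bool; nia.
Qed.

End ProjectiveCycle.
End Ring.

(** * The Platonic maps and their antipodal quotients *)

Local Notation at_ t i := (nth 0 t i).

Section Tables.
Variable n : nat.
Implicit Types t u : seq nat.

Definition valid t := all (fun i => at_ t i < n) (iota 0 n).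
Definition flipping t :=
  all (fun i => (at_ t (at_ t i) == i) && (at_ t i != i)) (iota 0 n).
Definition commuting t u := all (fun i => at_ t (at_ u i) == at_ u (at_ t i)) (iota 0 n).

(** Conditions are stated on lists of naturals so that they compute. The default [i] is never
    reached for a [valid] table. *)
Definition look t (i : 'I_n) : 'I_n := insubd i (at_ t i).

Lemma all_ord (P : pred nat) : all P (iota 0 n) -> forall i : 'I_n, P i.
Proof. by move/allP=> PT i; apply: PT; rewrite mem_iota /=. Qed.

Lemma val_look t i : valid t -> val (look t i) = at_ t i.
Proof. by move/all_ord=> /(_ i) ti; rewrite val_insubd ti. Qed.

Lemma look_comm t u : valid t -> valid u -> commuting t u ->
  forall i, look t (look u i) = look u (look t i).
Proof.
move=> tv uv /all_ord tu i; apply: val_inj; rewrite !val_look //.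
exact/eqP/tu.
Qed.

Lemma lookK t : valid t -> flipping t -> involutive (look t).
Proof.
move=> tv /all_ord tf i; apply: val_inj; rewrite !val_look //.
by case/andP: (tf i) => /eqP.
Qed.

Lemma look_neq t : valid t -> flipping t -> forall i, look t i != i.
Proof.
by move=> tv /all_ord tf i; rewrite -val_eqE /= val_look //; case/andP: (tf i).
Qed.

Section TableMap.
Variables (t0 t1 t2 u0 u1 u2 : seq nat) (k l : nat).

Definition rotation_order t u m :=
  let r i := at_ u (at_ t i) in
  (iter m r 0 == 0) && all (fun j => iter j r 0 != 0) (iota 1 m.-1).

Definition table_structure :=
  [&& 0 < n, all valid [:: t0; t1; t2], all flipping [:: t0; t1; t2],
      commuting t0 t2 & all (fun i => at_ t0 i != at_ t2 i) (iota 0 n)].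

(** Descending to a neighbour of smaller index leads every flag to flag 0, so this check implies
    connectedness. *)
Definition table_connected :=
  all (fun i => (i == 0) || [|| at_ t0 i < i, at_ t1 i < i | at_ t2 i < i])
    (iota 0 n).

(** Only flag 0 has to be moved to its neighbours: three such tables give full regularity by
    [fully_regular_neighbours]. *)
Definition table_aut t u :=
  [&& valid u, commuting u t0, commuting u t1, commuting u t2
    & at_ u 0 == at_ t 0].

Definition table_types :=
  [&& 0 < k, 0 < l, rotation_order t1 t2 k & rotation_order t0 t1 l].

Hypotheses (structure : table_structure) (connected : table_connected).
Hypotheses (aut0 : table_aut t0 u0) (aut1 : table_aut t1 u1) (aut2 : table_aut t2 u2).
Hypothesis types : table_types.

Let n_gt0 : 0 < n. Proof. by case/and5P: structure. Qed.
Let v0 : valid t0. Proof. by case/and5P: structure => _ /= /and4P[]. Qed.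
Let v1 : valid t1. Proof. by case/and5P: structure => _ /= /and4P[]. Qed.
Let v2 : valid t2. Proof. by case/and5P: structure => _ /= /and4P[]. Qed.
Let f0 : flipping t0. Proof. by case/and5P: structure => _ _ /= /and4P[]. Qed.
Let f1 : flipping t1. Proof. by case/and5P: structure => _ _ /= /and4P[]. Qed.
Let f2 : flipping t2. Proof. by case/and5P: structure => _ _ /= /and4P[]. Qed.
Let c02 : commuting t0 t2. Proof. by case/and5P: structure. Qed.

Fact table_nonempty : 0 < #|'I_n|. Proof. by rewrite card_ord. Qed.

Fact table_connect (x y : 'I_n) :
  connect (fun a b => [|| b == look t0 a, b == look t1 a | b == look t2 a]) x y.
Proof.
pose e (a b : 'I_n) := [|| b == look t0 a, b == look t1 a | b == look t2 a].
rewrite -[connect _ x y]/(connect e x y).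
have e_sym : connect_sym e.
  apply: sym_connect_sym => a b; rewrite /e -(inv_eq (lookK v0 f0)).
  by rewrite -(inv_eq (lookK v1 f1)) -(inv_eq (lookK v2 f2)) !(eq_sym a).
suff H z : connect e z (Ordinal n_gt0).
  by apply: connect_trans (H x) _; rewrite e_sym.
have [m] := ubnP z; elim: m z => // m IHm z; rewrite ltnS => zm.
have := all_ord connected z; case: eqP => [z0 _|_] /=.
  by rewrite (_ : z = Ordinal n_gt0) //; apply: val_inj.
case/or3P=> lt_z.
- apply: (@connect_trans _ _ (look t0 z)); first by rewrite connect1 // /e eqxx.
  by apply: IHm; apply: leq_trans zm; rewrite val_look.
- apply: (@connect_trans _ _ (look t1 z)); first by rewrite connect1 // /e eqxx orbT.
  by apply: IHm; apply: leq_trans zm; rewrite val_look.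
- apply: (@connect_trans _ _ (look t2 z)); first by rewrite connect1 // /e eqxx !orbT.
  by apply: IHm; apply: leq_trans zm; rewrite val_look.
Qed.

Definition table_map : smap :=
  SMap (lookK v0 f0) (lookK v1 f1) (lookK v2 f2) (look_neq v0 f0)
       (look_neq v1 f1) (look_neq v2 f2) (look_comm v0 v2 c02)
       table_nonempty table_connect.

Let x0 : table_map := Ordinal n_gt0.

Lemma table_proper : is_proper table_map.
Proof.
apply/is_properP=> x; rewrite -val_eqE /= !val_look //.
by case/and5P: structure => _ _ _ _ /all_ord.
Qed.

Let table_morph t u : valid t -> table_aut t u ->
  exists2 f : table_map -> table_map, flag_morph f & f x0 = look t x0.
Proof.
move=> tv /and5P[uv c0 c1 c2 /eqP e]; exists (look u).
  by move=> x; split; apply: look_comm.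
by apply: val_inj; rewrite !val_look.
Qed.

Lemma table_regular : fully_regular table_map.
Proof.
apply: (@fully_regular_neighbours _ x0).
- exact: (table_morph v0 aut0).
- exact: (table_morph v1 aut1).
- exact: (table_morph v2 aut2).
Qed.

Let iter_look t u i : valid t -> valid u ->
  val (iter i (look u \o look t) x0) = iter i (fun j => at_ u (at_ t j)) 0.
Proof. by move=> tv uv; elim: i => //= i <-; rewrite !val_look. Qed.

Let table_order t u m : valid t -> flipping t -> valid u -> flipping u ->
  0 < m -> rotation_order t u m -> order (look u \o look t) x0 = m.
Proof.
move=> tv tf uv uf m_gt0 /andP[/eqP im /allP imin].
apply: order_eq => //; first exact: dihedral_rot_inj (lookK tv tf) (lookK uv uf).
  by apply: val_inj; rewrite iter_look.
move=> i im'; rewrite -val_eqE iter_look //; apply: imin.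
by rewrite mem_iota; lia.
Qed.

Lemma table_type : has_type table_map k l.
Proof.
case/and4P: types => k0 l0 tk tl.
have := regular_type x0 table_regular.
rewrite [X in has_type _ X](table_order v1 f1 v2 f2 k0 tk).
by rewrite [X in has_type _ _ X](table_order v0 f0 v1 f1 l0 tl).
Qed.

(** All edges are full, V = n / 2k and F = n / 2l, so that 4 (V + F) is the right-hand side of the
    hypothesis. *)
Lemma table_euler q : 4 * q + n = 2 * (n %/ k + n %/ l) -> euler_char table_map = q%:Z%R.
Proof.
move=> e; apply/euler_charP; rewrite card_proper_flags; last exact: table_proper.
case/and4P: types => k0 l0 _ _.
have := card_vertices table_type; have := card_faces table_type.
rewrite !(card_ord n : #|table_map| = n) => nF nV; rewrite e.
have -> : n %/ k = #|vertices table_map| * 2 by rewrite [X in X %/ _]nV mulnA mulnK.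
have -> : n %/ l = #|faces table_map| * 2 by rewrite [X in X %/ _]nF mulnA mulnK.
lia.
Qed.

Lemma table_sphere (o : seq bool) :
  all (fun i => all (fun t => nth false o (at_ t i) == ~~ nth false o i) [:: t0; t1; t2])
    (iota 0 n) ->
  4 * 2 + n = 2 * (n %/ k + n %/ l) -> supports_regular on_sphere k l.
Proof.
move=> /all_ord oP e; exists table_map.
split; [|exact: table_proper|exact: table_regular|exact: table_type].
split; last exact: (table_euler e).
exists (fun x : table_map => nth false o (x : 'I_n)) => x; rewrite /= !val_look //.
by case/and4P: (oP x) => /eqP -> /eqP -> /eqP ->.
Qed.

(** A closed path of odd length, [m] times the three gluing maps, contradicts any orientation. *)
Lemma table_projective_plane m :
  odd m -> iter m (fun i => at_ t0 (at_ t1 (at_ t2 i))) 0 = 0 ->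
  4 + n = 2 * (n %/ k + n %/ l) -> supports_regular on_projective_plane k l.
Proof.
move=> m_odd im e; exists table_map.
split; [|exact: table_proper|exact: table_regular|exact: table_type].
split; last exact: (table_euler (q := 1) e).
case=> o oP; pose r := look t0 \o (look t1 \o look t2).
have or x : o (r x) = ~~ o x.
  have [o0 _ _] := oP (look t1 (look t2 x)); have [_ o1 _] := oP (look t2 x).
  have [_ _ o2] := oP x; rewrite [LHS]o0 [X in ~~ X]o1 [X in ~~ ~~ X]o2.
  by rewrite negbK.
have oi i : o (iter i r x0) = odd i (+) o x0.
  by elim: i => // i IHi; rewrite iterS or IHi addNb.
have := oi m; rewrite (_ : iter m r x0 = x0) ?m_odd; first by case: (o x0).
apply: val_inj; rewrite -[RHS]im {m_odd im}.
by elim: m => //= m <-; rewrite !val_look.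
Qed.

End TableMap.
End Tables.

(* A permutation of [0, ..., d-1] is the list of its values; [span] lists the
   elements of a group in breadth first order, which makes [table_connected]
   hold for its Cayley tables. *)
Definition pcomp (s g : seq nat) := [seq nth 0 s i | i <- g].

Fixpoint span (gens : seq (seq nat)) m G :=
  if m isn't m'.+1 then G else
  span gens m' (foldl (fun l x => if x \in l then l else rcons l x) G
                  [seq pcomp x g | x <- G, g <- gens]).

(** Flags are group elements, flag 0 being the identity. Left multiplications commute with the
    gluing by right multiplications, and both send the identity to the same generator, as
    [table_aut] asks. *)
Definition rtable G g := [seq index (pcomp x g) G | x <- G].
Definition ltable G g := [seq index (pcomp g x) G | x <- G].

Definition cayley_check (check : seq nat -> seq nat -> seq nat -> bool)
    G r0 r1 r2 k l :=
  let n := size G in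
  let t0 := rtable G r0 in let t1 := rtable G r1 in let t2 := rtable G r2 in
  [&& table_structure n t0 t1 t2, table_connected n t0 t1 t2,
      [&& table_aut n t0 t1 t2 t0 (ltable G r0),
          table_aut n t0 t1 t2 t1 (ltable G r1)
        & table_aut n t0 t1 t2 t2 (ltable G r2)],
      table_types t0 t1 t2 k l & check t0 t1 t2].

Definition sphere_check (G : seq (seq nat)) k l t0 t1 t2 :=
  let n := size G in
  (* For [signed] generators the first entry of a product is 0 exactly when the word is even. *)
  let o := [seq head 0 x == 0 | x <- G] in
  all (fun i => all (fun t => nth false o (at_ t i) == ~~ nth false o i)
                    [:: t0; t1; t2]) (iota 0 n)
  && (4 * 2 + n == 2 * (n %/ k + n %/ l)).

Definition projective_check (G : seq (seq nat)) k l m t0 t1 t2 :=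
  let n := size G in
  [&& odd m, iter m (fun i => at_ t0 (at_ t1 (at_ t2 i))) 0 == 0
    & 4 + n == 2 * (n %/ k + n %/ l)].

Lemma cayley_sphere G r0 r1 r2 k l :
  cayley_check (sphere_check G k l) G r0 r1 r2 k l -> supports_regular on_sphere k l.
Proof.
case/and5P=> structure connected /and3P[a0 a1 a2] types /andP[oP /eqP e].
exact (table_sphere structure connected a0 a1 a2 types oP e).
Qed.

Lemma cayley_projective_plane G r0 r1 r2 k l m :
  cayley_check (projective_check G k l m) G r0 r1 r2 k l ->
  supports_regular on_projective_plane k l.
Proof.
case/and5P=> structure connected /and3P[a0 a1 a2] types /and3P[m_odd /eqP im /eqP e].
exact (table_projective_plane structure connected a0 a1 a2 types m_odd im e).
Qed.

(* [signed g] also swaps two further points, so that the parity of a word in such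
   generators can be read off the product: the map becomes orientable. *)
Definition signed g := [:: 1, 0 & [seq i.+2 | i <- g]].

(** The group is S4 with its Coxeter generators. The depths 6, 9 and 15 of [span], here and for the
    two solids below, are the lengths of the longest elements of the Coxeter groups A3, B3 and
    H3. *)
Lemma tetrahedron : supports_regular on_sphere 3 3.
Proof.
pose r0 := signed [:: 1; 0; 2; 3]; pose r1 := signed [:: 0; 2; 1; 3].
pose r2 := signed [:: 0; 1; 3; 2].
by apply: (@cayley_sphere (span [:: r0; r1; r2] 6 [:: iota 0 6]) r0 r1 r2); vm_compute.
Qed.

(** Without the sign the generators only give S4; with it they give S4 x C2, whose 48 elements are
    the flags. *)
Lemma cube : supports_regular on_sphere 3 4.
Proof.
pose r0 := signed [:: 1; 0; 3; 2]; pose r1 := signed [:: 0; 2; 1; 3].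
pose r2 := signed [:: 0; 1; 3; 2].
by apply: (@cayley_sphere (span [:: r0; r1; r2] 9 [:: iota 0 6]) r0 r1 r2); vm_compute.
Qed.

(** The three permutations are even and generate A5; the sign doubles it to the 120 flags. *)
Lemma dodecahedron : supports_regular on_sphere 3 5.
Proof.
pose r0 := signed [:: 3; 4; 2; 0; 1]; pose r1 := signed [:: 0; 2; 1; 4; 3].
pose r2 := signed [:: 1; 0; 2; 4; 3].
by apply: (@cayley_sphere (span [:: r0; r1; r2] 15 [:: iota 0 7]) r0 r1 r2); vm_compute.
Qed.

(** Dropping the sign divides the cube by its antipodal map. The final 3 is an odd number of rounds
    through the three gluing maps that closes up; for the dodecahedron it is 5. *)
Lemma hemicube : supports_regular on_projective_plane 3 4.
Proof.
pose r0 := [:: 1; 0; 3; 2]; pose r1 := [:: 0; 2; 1; 3]; pose r2 := [:: 0; 1; 3; 2].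
by apply: (@cayley_projective_plane
  (span [:: r0; r1; r2] 9 [:: iota 0 4]) r0 r1 r2 _ _ 3); vm_compute.
Qed.

Lemma hemidodecahedron : supports_regular on_projective_plane 3 5.
Proof.
pose r0 := [:: 3; 4; 2; 0; 1]; pose r1 := [:: 0; 2; 1; 4; 3]; pose r2 := [:: 1; 0; 2; 4; 3].
by apply: (@cayley_projective_plane
  (span [:: r0; r1; r2] 15 [:: iota 0 5]) r0 r1 r2 _ _ 5); vm_compute.
Qed.

(** * Proper edge-biregular maps *)

Section Cycle.
Variables (M : smap) (c : M -> bool).
Hypotheses (alt : alternate c) (proper : is_proper M).
Hypothesis vertex4 : forall x : M, #|vertex_of x| = 4.
Implicit Types x y z : M.

Let order_vertex x : order (@across M \o @turn M) x = 2.
Proof. by have := vertex4 x; rewrite card_vertex_of; lia. Qed.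

Let vertex_rot_inj : injective (@across M \o @turn M).
Proof. exact: dihedral_rot_inj (@turnK M) (@acrossK M). Qed.

Let turn_acrossC x : turn (across x) = across (turn x).
Proof.
have := iter_fixed_order vertex_rot_inj 2 (turn x); rewrite order_vertex /=.
by rewrite turnK (inv_eq (@acrossK M)) => /eqP.
Qed.

Let turn_neq_across x : turn x != across x.
Proof.
have := iter_fixed_order vertex_rot_inj 1 x; rewrite order_vertex /=.
by rewrite (inv_eq (@acrossK M)) => ->.
Qed.

Let along_neq_across x : along x != across x.
Proof. exact: (is_properP M).1. Qed.

(* Along a cycle the map is a band, whose two sides are swapped by [across];
   [sim] identifies them and [step] goes to the next vertex of the cycle. *)
Let step := @turn M \o @along M.
Let sim y z := (y == z) || (y == across z).

Let sim_refl y : sim y y. Proof. by rewrite /sim eqxx. Qed.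

Let sim_sym y z : sim y z = sim z y.
Proof. by rewrite /sim [z == across y]eq_sym (inv_eq (@acrossK M)) eq_sym. Qed.

Let sim_across y z : sim (across y) z = sim y z.
Proof. by rewrite /sim (inj_eq (inv_inj (@acrossK M))) (inv_eq (@acrossK M)) orbC. Qed.

Let sim_turn y z : sim (turn y) z = sim y (turn z).
Proof. by rewrite /sim !(inv_eq (@turnK M)) turn_acrossC. Qed.

Let sim_along y z : sim (along y) z = sim y (along z).
Proof. by rewrite /sim !(inv_eq (@alongK M)) along_acrossC. Qed.

Let sim_trans y x z : sim x y -> sim y z -> sim x z.
Proof. by case/orP=> /eqP->; rewrite ?sim_across. Qed.

(** The walk never meets its own reversal: shortening the path at both ends would identify [y] up to
    side with [turn y] or with [along y]. Valency 2 excludes the former, the absence of semi-edges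
    the latter. *)
Let path_not_sim_turn i y : ~~ sim (iter i step y) (turn y).
Proof.
elim/ltn_ind: i y => -[|[|i]] IHi y.
- rewrite sim_sym /sim /= negb_or turn_neq.
  exact: turn_neq_across.
- by rewrite /= sim_turn turnK /sim negb_or along_neq along_neq_across.
- rewrite iterS iterSr {1}/step /= sim_turn turnK sim_along.
  by have := IHi i _ (step y); rewrite {3}/step /= turnK; apply; lia.
Qed.

Variable x0 : M.
Let xi i := iter i step x0.

Let xi_not_sim_turn i j : ~~ sim (xi i) (turn (xi j)).
Proof.
have H a b : b <= a -> ~~ sim (xi a) (turn (xi b)).
  by move=> ba; rewrite /xi -(subnK ba) iterD path_not_sim_turn.
by have [/H//|/ltnW/H] := leqP j i; rewrite sim_sym sim_turn.
Qed.

Let pair y := [set y; across y].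
(** Acting on the classes [pair y] replaces [sim] by equality, so that [order] applies. *)
Let F (A : {set M}) := step @: A.

Let step_inj : injective step.
Proof. exact: dihedral_rot_inj (@alongK M) (@turnK M). Qed.

Let F_inj : injective F. Proof. exact: imset_inj step_inj. Qed.

Let simE y z : sim y z = (pair y == pair z).
Proof.
apply/idP/eqP=> [|e]; first by case/orP=> /eqP-> //; rewrite /pair acrossK setUC.
by have := set21 y (across y); rewrite -/(pair y) e !inE.
Qed.

Let iter_pair i : iter i F (pair x0) = pair (xi i).
Proof.
elim: i => // i IHi; rewrite iterS IHi /F /pair imsetU1 imset_set1.
by rewrite /step /= along_acrossC turn_acrossC.
Qed.

(** The length of the cycle: the period of the walk up to the side of the band. It can be smaller
    than the period of [step], when the walk returns at [across x0] first. *)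
Let n := order F (pair x0).
Let n_gt0 : 0 < n. Proof. exact: order_gt0. Qed.

Let sim_xi i j : sim (xi i) (xi j) = (i == j %[mod n]).
Proof.
rewrite simE -!iter_pair -(iter_mod_order F_inj) -[iter j _ _](iter_mod_order F_inj).
apply/eqP/eqP=> [e|-> //].
by rewrite -(findex_iter (ltn_pmod i n_gt0)) e findex_iter // ltn_pmod.
Qed.

Let n_even : ~~ odd n.
Proof.
have ci i : c (xi i) = odd i (+) c x0.
  elim: i => // i IHi; rewrite /xi iterS /step /= -[iter i _ _]/(xi i).
  have [_ _ ->] := alt (along (xi i)); have [-> _ _] := alt (xi i).
  by rewrite IHi addNb.
have : sim (xi n) (xi 0) by rewrite sim_xi modnn mod0n.
case/orP=> /eqP/(congr1 c); rewrite ci; last have [_ -> _] := alt x0.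
  by case: (odd n) (c x0) => [] [].
by case: (odd n) (c x0) => [] [].
Qed.

Let mem_vertex y z : (z \in vertex_of y) = sim z y || sim z (turn y).
Proof.
apply/idP/idP=> [|/orP[]].
- have /subsetP sub : vertex_of y \subset [set z | sim z y || sim z (turn y)].
    apply: dorbit_sub => [|u|u]; rewrite !inE ?sim_refl ?sim_across //.
    by rewrite !sim_turn turnK orbC.
  by move/sub; rewrite inE.
- by case/orP=> /eqP->; do ?apply: dorbit_b; apply: dorbit_refl.
- by case/orP=> /eqP->; do ?apply: dorbit_b; apply: dorbit_a; apply: dorbit_refl.
Qed.

Let mem_edge y z : (z \in edge_of y) = sim z y || sim z (along y).
Proof.
apply/idP/idP=> [|/orP[]].
- have /subsetP sub : edge_of y \subset [set z | sim z y || sim z (along y)].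
    apply: dorbit_sub => [|u|u]; rewrite !inE ?sim_refl ?sim_across //.
    by rewrite !sim_along alongK orbC.
  by move/sub; rewrite inE.
- by case/orP=> /eqP->; do ?apply: dorbit_b; apply: dorbit_refl.
- by case/orP=> /eqP->; do ?apply: dorbit_b; apply: dorbit_a; apply: dorbit_refl.
Qed.

Let vertex_eq y z : z \in vertex_of y -> vertex_of z = vertex_of y.
Proof. exact: (dorbit_eq (@turnK M) (@acrossK M)). Qed.

Let along_xi i : along (xi i) = turn (xi i.+1).
Proof. by rewrite /xi iterS /step /= turnK. Qed.

Let turn_xi i : exists j, turn (xi i) = along (xi j).
Proof.
(* The predecessor of [xi i], reached by walking forward a full period less one step. *)
exists (i + (order step x0).-1).
rewrite along_xi /xi -addnS prednK ?order_gt0 // iterD iter_order //.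
Qed.

Let all_sim y : exists i, sim y (xi i) \/ sim y (turn (xi i)).
Proof.
pose near z := exists i, sim z (xi i) \/ sim z (turn (xi i)).
move: y; apply: (@flag_ind _ near x0); first by exists 0; left; apply: sim_refl.
move=> y [i iy]; split.
- case: iy => [iy|].
    by exists i.+1; right; rewrite -along_xi sim_along alongK.
  have [j ->] := turn_xi i => jy.
  by exists j; left; rewrite sim_along.
- by exists i; rewrite !sim_turn turnK; case: iy; [right | left].
- by exists i; rewrite !sim_across.
Qed.

Let vi (i : 'I_n) := vertex_of (xi i).
Let ei (i : 'I_n) := edge_of (xi i).

Let sim_ord i : sim (xi i) (xi (Ordinal (ltn_pmod i n_gt0))).
Proof. by rewrite sim_xi /= modn_mod. Qed.

Let sim_xi_ord (i j : 'I_n) : sim (xi i) (xi j) -> i = j.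
Proof. by rewrite sim_xi !modn_small // => /eqP/val_inj. Qed.

Let vi_inj : injective vi.
Proof.
move=> i j ij; have : xi i \in vi j by rewrite -ij; apply: dorbit_refl.
by rewrite mem_vertex (negPf (xi_not_sim_turn _ _)) orbF => /sim_xi_ord.
Qed.

Let ei_inj : injective ei.
Proof.
move=> i j ij; have : xi i \in ei j by rewrite -ij; apply: dorbit_refl.
by rewrite mem_edge along_xi (negPf (xi_not_sim_turn _ _)) orbF => /sim_xi_ord.
Qed.

Let vi_onto : vi @: [set: 'I_n] = vertices M.
Proof.
apply/setP=> A; apply/imsetP/imsetP=> [[i _ ->]|[y _ ->]]; first by exists (xi i).
have [i iy] := all_sim y; exists (Ordinal (ltn_pmod i n_gt0)); rewrite ?inE //.
apply: vertex_eq; rewrite mem_vertex.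
case: iy => iy; apply/orP; [left | right]; apply: sim_trans iy _; first exact: sim_ord.
by rewrite sim_turn turnK; apply: sim_ord.
Qed.

Let ei_onto : ei @: [set: 'I_n] = edges M.
Proof.
apply/setP=> A; apply/imsetP/imsetP=> [[i _ ->]|[y _ ->]]; first by exists (xi i).
have [i iy] := all_sim y.
have [j jy] : exists j, sim y (xi j) \/ sim y (along (xi j)).
  case: iy => iy; first by exists i; left.
  by have [j e] := turn_xi i; exists j; right; rewrite -e.
exists (Ordinal (ltn_pmod j n_gt0)); rewrite ?inE //.
apply: mem_edge_of; rewrite mem_edge.
case: jy => jy; apply/orP; [left | right]; apply: sim_trans jy _; first exact: sim_ord.
by rewrite sim_along alongK; apply: sim_ord.
Qed.

Let incidence (i j : 'I_n) : ~~ [disjoint vi j & ei i] = (j == i) || (j == ordS i).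
Proof.
have simS : sim (xi i.+1) (xi (ordS i)) by rewrite sim_xi /= modn_mod.
apply/pred0Pn/orP=> [[y /andP[/= ]]|[] /eqP->].
(* A common flag is, up to side, [xi j] or [turn (xi j)], and also [xi i] or [turn (xi i.+1)]. The
   mixed cases are excluded since the walk never reverses; the others give j = i and j = i + 1
   modulo n. *)
- rewrite mem_vertex mem_edge along_xi => /orP[] yj /orP[] yi.
  + by left; apply/eqP/sim_xi_ord; apply: sim_trans yi; rewrite sim_sym.
  + have : sim (xi j) (turn (xi i.+1)) by apply: sim_trans yi; rewrite sim_sym.
    by rewrite (negPf (xi_not_sim_turn _ _)).
  + have : sim (xi i) (turn (xi j)) by apply: sim_trans yj; rewrite sim_sym.
    by rewrite (negPf (xi_not_sim_turn _ _)).
  + right; apply/eqP/sim_xi_ord; apply: sim_trans simS.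
    rewrite -[xi i.+1]turnK -sim_turn; apply: sim_trans yi; rewrite sim_sym.
    exact: yj.
- exists (xi i); apply/andP; split; exact: dorbit_refl.
- exists (along (xi i)); rewrite /= mem_vertex mem_edge sim_refl orbT andbT.
  by rewrite along_xi [X in _ || X]sim_turn turnK simS orbT.
Qed.

Lemma two_valent_even_cycle : embedded_even_cycle M.
Proof.
exists n; split=> //; split=> //; exists vi, ei; split=> //.
Qed.

End Cycle.

Lemma proper_biregular_cycle (M : smap) (c : M -> bool) l :
  edge_biregular c -> is_proper M -> has_type M 2 l -> embedded_even_cycle M.
Proof.
move=> [alt _] Mp Ml; have /card_gt0P[x0 _] := flag_nonempty M.
by apply: (two_valent_even_cycle alt Mp) => // x; have [-> _] := Ml x.
Qed.

Lemma proper_biregular_positive_euler (M : smap) (c : M -> bool) q :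
  edge_biregular c -> is_proper M -> 0 < q -> euler_char M = q%:Z%R ->
  exists2 m, 0 < m & has_type M 2 (2 * m) \/ has_type M (2 * m) 2.
Proof.
move=> bireg Mp q_gt0 /euler_charP; rewrite card_proper_flags //.
have [k [l [k_gt0 l_gt0 Mkl]]] := biregular_type bireg => e.
have cV := card_vertices Mkl; have cF := card_faces Mkl.
have [k1|k_neq1] := eqVneq k 1; first by exists l => //; left; rewrite k1 in Mkl.
have [l1|l_neq1] := eqVneq l 1; first by exists k => //; right; rewrite l1 in Mkl.
(* With k and l at least 2 these two bounds give 4 (V + F) <= |M|, against 4 q + |M| = 4 (V + F). *)
have : #|M| >= #|vertices M| * 8 by rewrite cV leq_mul2l; lia.
have : #|M| >= #|faces M| * 8 by rewrite cF leq_mul2l; lia.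
lia.
Qed.

Theorem mainTheorem4 :
  (* (i) both edge orbits consist of semi-edges *)
  [/\ forall v : nat, 0 < v -> ~~ odd v ->
        exists (M : smap) (c : M -> bool),
          [/\ semistar M v, on_sphere M & edge_biregular c],
      forall (v : nat) (M : smap), ~~ odd v ->
        semistar M v -> on_sphere M -> fully_regular M
    & forall (M : smap) (c : M -> bool),
        edge_biregular c -> #|semi_edge_orbits c| = 2 -> on_sphere M]
  /\
  (* (ii) exactly one orbit of semi-edges *)
  [/\ forall (M : smap) (c : M -> bool),
        edge_biregular c -> on_sphere M \/ on_projective_plane M ->
        #|semi_edge_orbits c| = 1 ->
        exists M0 : smap, fully_regular M0 /\ attached_from M0 c,
      forall k l : nat,
        (k, l) \in [:: (3, 3); (3, 4); (4, 3); (3, 5); (5, 3)] ->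
        supports_regular on_sphere k l /\
        supports_one_orbit_biregular on_sphere (2 * k) (2 * l),
      forall m : nat, 0 < m ->
        [/\ supports_regular on_sphere 2 m,
            supports_regular on_sphere m 2,
            supports_one_orbit_biregular on_sphere 4 (2 * m)
          & supports_one_orbit_biregular on_sphere (2 * m) 4],
      forall k l : nat,
        (k, l) \in [:: (3, 4); (4, 3); (3, 5); (5, 3)] ->
        supports_regular on_projective_plane k l /\
        supports_one_orbit_biregular on_projective_plane (2 * k) (2 * l)
    & (* a 2-valent map on the projective plane has a single face, which is on
         both sides of every edge, so that m has to be even *)
      forall m : nat, 0 < m -> ~~ odd m ->
        [/\ supports_regular on_projective_plane 2 m,
            supports_regular on_projective_plane m 2,
            supports_one_orbit_biregular on_projective_plane 4 (2 * m)
          & supports_one_orbit_biregular on_projective_plane (2 * m) 4]]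
  /\
  (* (iii) no semi-edges *)
  (forall (M : smap) (c : M -> bool),
     edge_biregular c -> is_proper M -> on_sphere M \/ on_projective_plane M ->
     exists2 m : nat, 0 < m &
       (embedded_even_cycle M /\ has_type M 2 (2 * m)) \/
       (embedded_even_cycle (dual M) /\ has_type M (2 * m) 2)).
Proof.
pose dS k l := @supports_dual on_sphere k l dual_sphere.
pose dP k l := @supports_dual on_projective_plane k l dual_projective_plane.
have aS k l := @supports_attach on_sphere k l (fun M => @attach_sphere M k l).
have aP k l := @supports_attach on_projective_plane k l
  (fun M => @attach_projective_plane M k l).
split; [split|split; [split|]].
- move=> v v_gt0 v_even; exists (star_map v_gt0).
  exists (fun p : star_map v_gt0 => odd p.1 (+) p.2).
  split; [exact: star_semistar|exact: all_semi_sphere|exact: star_biregular].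
- by move=> v M _ /semistar_all_semi allS _; apply: all_semi_regular.
- by move=> M c bireg /(two_orbits_all_semi bireg); apply: all_semi_sphere.
- by move=> M c bireg _; apply: one_orbit_attached.
(* Attaching is uniform in the type, so only regular maps have to be exhibited; octahedron and
   icosahedron are the duals of the cube and the dodecahedron. *)
- suff H k l : (k, l) \in [:: (3, 3); (3, 4); (4, 3); (3, 5); (5, 3)] ->
      supports_regular on_sphere k l by move=> k l /H; split=> //; apply: aS.
  rewrite !inE => /or4P[||| /orP[]] /eqP[-> ->].
  + exact: tetrahedron.
  + exact: cube.
  + exact: dS cube.
  + exact: dodecahedron.
  + exact: dS dodecahedron.
- move=> m m_gt0; have R : supports_regular on_sphere 2 m.
    exists (sphere_cycle m_gt0); split; [exact: sphere_cycle_sphere|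
      exact: sphere_cycle_proper|exact: sphere_cycle_regular|exact: sphere_cycle_type].
  by split=> //; [exact: dS | exact: aS R | exact: aS (dS _ _ R)].
- suff H k l : (k, l) \in [:: (3, 4); (4, 3); (3, 5); (5, 3)] ->
      supports_regular on_projective_plane k l by move=> k l /H; split=> //; apply: aP.
  rewrite !inE => /or4P[] /eqP[-> ->].
  + exact: hemicube.
  + exact: dP hemicube.
  + exact: hemidodecahedron.
  + exact: dP hemidodecahedron.
- move=> m m_gt0 m_even; have R : supports_regular on_projective_plane 2 m.
    exists (projective_cycle m_gt0 m_even); split;
      [exact: projective_cycle_projective_plane|exact: projective_cycle_proper|
       exact: projective_cycle_regular|exact: projective_cycle_type].
  by split=> //; [exact: dP | exact: aP R | exact: aP (dP _ _ R)].
- move=> M c bireg Mp MS.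
  have [m m_gt0 Mm] : exists2 m, 0 < m & has_type M 2 (2 * m) \/ has_type M (2 * m) 2.
    by case: MS => -[_]; [apply: (proper_biregular_positive_euler (q := 2) bireg)
                         | apply: (proper_biregular_positive_euler (q := 1) bireg)].
  exists m => //; case: Mm => Mm; [left | right]; split=> //.
    exact: proper_biregular_cycle bireg Mp Mm.
  exact: proper_biregular_cycle (dual_biregular bireg) (dual_proper Mp) (dual_type Mm).
Qed.
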